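(* Let $\delta>0$ and let $K\ge 1$, $T=KH$. Consider the algorithm UCBVI-CH (UCBVI with the Chernoff–Hoeffding bonus) run for $K$ episodes on any MDP satisfying the standing assumptions. Then, with probability at least $1-\delta$, $$\mathrm{Regret}(K)\;\le\; 20\,H^{3/2}L\sqrt{SAK}+250\,H^2S^2A\,L^2,$$ where $L=\ln(5HSAT/\delta)$.
   Context: Setting: a finite-horizon episodic Markov decision process with finite state set $\mathcal S$ ($|\mathcal S|=S$), finite action set $\mathcal A$ ($|\mathcal A|=A$), unknown transition kernel $P(\cdot\mid x,a)$, known deterministic reward function $R:\mathcal S\times\mathcal A\to[0,1]$, and known horizon $H$. In each episode $k=1,\dots,K$, an initial state $x_{k,1}$ is chosen arbitrarily by the environment (it may change arbitrarily between episodes); then for $h=1,\dots,H$ the agent picks $a_{k,h}\in\mathcal A$ and observes $x_{k,h+1}\sim P(\cdot\mid x_{k,h},a_{k,h})$. A policy is a map $\pi:\mathcal S\times[H]\to\mathcal A$. Its value is $V^\pi_h(x)=\mathbb E\big[\sum_{j=h}^{H}R(x_j,\pi(x_j,j))\mid x_h=x\big]$ (trajectory generated by $P$ and $\pi$), $V^\pi_{H+1}\equiv 0$, and $V^*_h(x)=\sup_\pi V^\pi_h(x)$. If $\pi_k$ is the policy followed in episode $k$, $\mathrm{Regret}(K)=\sum_{k=1}^K\big(V^*_1(x_{k,1})-V^{\pi_k}_1(x_{k,1})\big)$. $T=KH$. Algorithm UCBVI (with a bonus rule $b$): before episode $k$, using all transitions $(x_{i,h},a_{i,h},x_{i,h+1})$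 from episodes $i<k$, let $N_k(x,a,y)$ be the number of such transitions with $(x_{i,h},a_{i,h},x_{i,h+1})=(x,a,y)$, $N_k(x,a)=\sum_y N_k(x,a,y)$, and $\widehat P_k(y\mid x,a)=N_k(x,a,y)/N_k(x,a)$ when $N_k(x,a)>0$. Set $V_{k,H+1}\equiv 0$ and $Q_{0,h}\equiv H$. For $h=H,H-1,\dots,1$ and every $(x,a)$: if $N_k(x,a)>0$, $$Q_{k,h}(x,a)=\min\Big(Q_{k-1,h}(x,a),\,H,\,R(x,a)+\textstyle\sum_y\widehat P_k(y\mid x,a)V_{k,h+1}(y)+b_{k,h}(x,a)\Big),$$ otherwise $Q_{k,h}(x,a)=H$; and $V_{k,h}(x)=\max_a Q_{k,h}(x,a)$. In episode $k$, at step $h$ the agent takes $a_{k,h}\in\arg\max_a Q_{k,h}(x_{k,h},a)$; $\pi_k$ denotes this greedy policy. UCBVI-CH is UCBVI with bonus $b_{k,h}(x,a)=7HL'\sqrt{1/N_k(x,a)}$, where $L'=\ln(5SAT/\delta)$. *)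

(* Defs.v *)
From Stdlib Require Import Reals.
From mathcomp Require Import all_boot.
Set Implicit Arguments. Unset Strict Implicit. Unset Printing Implicit Defensive.

Local Open Scope R_scope.

(* A transition (x, a, y). States range over a finType X (|S| = #|X|),
   actions over a finType Ac (|A| = #|Ac|). Steps are indexed h = 1..H. *)
Definition transition (X Ac : finType) := (X * Ac * X)%type.

Definition N3 (X Ac : finType) (hs : seq (transition X Ac)) (x : X) (a : Ac) (y : X) : nat :=
  count (pred1 (x, a, y)) hs.
Definition N2 (X Ac : finType) (hs : seq (transition X Ac)) (x : X) (a : Ac) : nat :=
  count (fun t : transition X Ac => (t.1.1 == x) && (t.1.2 == a)) hs.

Definition bonus_CH (nS nA H K : nat) (delta : R) (n : nat) : R :=
  7 * INR H * ln (5 * INR nS * INR nA * INR (K * H) / delta) * sqrt (1 / INR n).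

(* Backward computation of Q_{k,h}(x,a) inside episode k, with fuel m = H+1-h.
   Qprev = Q_{k-1,.}, hs = transitions of episodes i < k, b = bonus as function
   of N_k(x,a).  V_{k,h+1}(y) = max_a Q_{k,h+1}(y,a), and V_{k,H+1} = 0. *)
Fixpoint Qin (X Ac : finType) (a0 : Ac) (rew : X -> Ac -> R) (H : nat)
    (b : nat -> R) (Qprev : nat -> X -> Ac -> R) (hs : seq (transition X Ac))
    (m h : nat) (x : X) (a : Ac) : R :=
  match m with
  | O => 0
  | S m' =>
    if (0 < N2 hs x a)%N then
      Rmin (Qprev h x a)
        (Rmin (INR H)
          (rew x a
           + \big[Rplus/0]_(y : X)
               (INR (N3 hs x a y) / INR (N2 hs x a)
                * \big[Rmax/Qin a0 rew H b Qprev hs m' h.+1 y a0]_(a' : Ac)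
                      Qin a0 rew H b Qprev hs m' h.+1 y a')
           + b (N2 hs x a)))
    else INR H
  end.

Fixpoint Qfun (X Ac : finType) (a0 : Ac) (rew : X -> Ac -> R) (H : nat)
    (b : nat -> R) (k : nat) (hist : seq (seq (transition X Ac)))
    : nat -> X -> Ac -> R :=
  match k with
  | O => fun _ _ _ => INR H
  | S k' => fun h x a =>
      Qin a0 rew H b (Qfun a0 rew H b k' hist) (flatten (take k' hist))
          (H.+1 - h) h x a
  end.

Definition Qnext (X Ac : finType) (a0 : Ac) (rew : X -> Ac -> R) (H : nat)
    (b : nat -> R) (hist : seq (seq (transition X Ac))) : nat -> X -> Ac -> R :=
  Qfun a0 rew H b (size hist).+1 hist.

Fixpoint Vpi_aux (X Ac : finType) (P : X -> Ac -> X -> R) (rew : X -> Ac -> R)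
    (pol : X -> nat -> Ac) (m h : nat) (x : X) : R :=
  match m with
  | O => 0
  | S m' => rew x (pol x h)
            + \big[Rplus/0]_(y : X) (P x (pol x h) y * Vpi_aux P rew pol m' h.+1 y)
  end.
Definition Vpi (X Ac : finType) (P : X -> Ac -> X -> R) (rew : X -> Ac -> R)
    (H : nat) (pol : X -> nat -> Ac) (h : nat) (x : X) : R :=
  Vpi_aux P rew pol (H.+1 - h) h x.

(* A policy S x [H] -> A, given as a finite function on X * 'I_H (step h <-> index h-1). *)
Definition ffpol (X Ac : finType) (H : nat) (a0 : Ac) (f : {ffun X * 'I_H -> Ac})
    : X -> nat -> Ac :=
  fun x h => match (insub h.-1 : option 'I_H) with Some j => f (x, j) | None => a0 end.

(* V*_h(x) = sup over all policies S x [H] -> A (a finite, nonempty set: the max). *)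
Definition Vstar (X Ac : finType) (P : X -> Ac -> X -> R) (rew : X -> Ac -> R)
    (H : nat) (a0 : Ac) (h : nat) (x : X) : R :=
  \big[Rmax/Vpi P rew H (fun _ _ => a0) h x]_(f : {ffun X * 'I_H -> Ac})
      Vpi P rew H (ffpol a0 f) h x.

Fixpoint ep_exp (X Ac : finType) (P : X -> Ac -> X -> R) (pol : X -> nat -> Ac)
    (n h : nat) (x : X) (g : seq (transition X Ac) -> R) : R :=
  match n with
  | O => g [::]
  | S n' => \big[Rplus/0]_(y : X)
              (P x (pol x h) y
               * ep_exp P pol n' h.+1 y (fun tr => g ((x, pol x h, y) :: tr)))
  end.

(* Expectation over k further episodes of f (history of all episodes), where before
   each episode the agent's policy and the initial state are functions of the past. *)
Fixpoint run_exp (X Ac : finType) (P : X -> Ac -> X -> R) (H : nat)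
    (agent : seq (seq (transition X Ac)) -> X -> nat -> Ac)
    (init : seq (seq (transition X Ac)) -> X)
    (k : nat) (hist : seq (seq (transition X Ac)))
    (f : seq (seq (transition X Ac)) -> R) : R :=
  match k with
  | O => f hist
  | S k' => ep_exp P (agent hist) H 1 (init hist)
              (fun tr => run_exp P H agent init k' (rcons hist tr) f)
  end.

Definition regret (X Ac : finType) (P : X -> Ac -> X -> R) (rew : X -> Ac -> R)
    (H : nat) (a0 : Ac)
    (agent : seq (seq (transition X Ac)) -> X -> nat -> Ac)
    (init : seq (seq (transition X Ac)) -> X)
    (hist : seq (seq (transition X Ac))) : R :=
  \big[Rplus/0]_(k < size hist)
     (Vstar P rew H a0 1 (init (take k hist))
      - Vpi P rew H (agent (take k hist)) 1 (init (take k hist))).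

Definition prob_run (X Ac : finType) (P : X -> Ac -> X -> R) (H : nat)
    (agent : seq (seq (transition X Ac)) -> X -> nat -> Ac)
    (init : seq (seq (transition X Ac)) -> X) (K : nat)
    (E : seq (seq (transition X Ac)) -> Prop)
    (Edec : forall hist, {E hist} + {~ E hist}) : R :=
  run_exp P H agent init K [::] (fun hist => if Edec hist then 1 else 0).

(* Main.v *)
From HB Require Import structures.
From Stdlib Require Import Reals Lra.
From mathcomp Require Import all_boot.
Require Import Defs.
Set Implicit Arguments. Unset Strict Implicit. Unset Printing Implicit Defensive.
Local Open Scope R_scope.

(** All failure events are controlled by one nonnegative supermartingale, a
    weighted sum of exponential martingales with initial value at most [delta];
    by Ville's inequality it stays below [1] outside an event of probability
    [delta].  It encodes
    - Hoeffding bounds for [(Phat - P) Vstar], which give optimism [Vstar <= V_k];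
    - multiplicative Chernoff bounds [Phat <= (1 + lam) P + l2 / (lam N)], which,
      applied to [0 <= V_k - Vstar <= V_k - V^pi_k], replace [(Phat - P)(V_k - Vstar)]
      by [lam P (V_k - V^pi_k)] plus a term of order [1 / N];
    - one multiplicative bound comparing, along the whole run, the conditional
      means of the gaps [V_k - V^pi_k] at the next state with their realised values,
      at a cost independent of [K].
    With [lam = 1 / (50 H)] the factors [1 + lam] compound over an episode to at
    most [25 / 24].  What remains is the sum of the per-step costs
    [beta / sqrt N + kappa / N], which telescopes against a potential of the visit
    counts. *)

(** * Monoid laws on the reals, for iterated sums *)

HB.instance Definition _ := Monoid.isComLaw.Build R 0 Rplus
  (fun x y z => esym (Rplus_assoc x y z)) Rplus_comm Rplus_0_l.
HB.instance Definition _ := Monoid.isComLaw.Build R 1 Rmult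
  (fun x y z => esym (Rmult_assoc x y z)) Rmult_comm Rmult_1_l.
HB.instance Definition _ := Monoid.isMulLaw.Build R 0 Rmult Rmult_0_l Rmult_0_r.
HB.instance Definition _ := Monoid.isAddLaw.Build R Rmult Rplus
  (fun x y z => Rmult_plus_distr_r x y z) (fun x y z => Rmult_plus_distr_l x y z).

Local Notation "\Sum_ i F" := (\big[Rplus/0]_i F)
  (at level 36, F at level 36, i at level 0).

(** * Finite sums and maxima of reals *)

Lemma sumR_le (I : Type) (r : seq I) (Q : pred I) (F G : I -> R) :
  (forall i, Q i -> F i <= G i) ->
  \big[Rplus/0]_(i <- r | Q i) F i <= \big[Rplus/0]_(i <- r | Q i) G i.
Proof.
move=> le_FG; apply: (big_ind2 Rle) => // [|x1 x2 y1 y2]; first exact: Rle_refl.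
exact: Rplus_le_compat.
Qed.

Lemma sumR_ge0 (I : Type) (r : seq I) (Q : pred I) (F : I -> R) :
  (forall i, Q i -> 0 <= F i) -> 0 <= \big[Rplus/0]_(i <- r | Q i) F i.
Proof. by move=> F0; apply: big_ind => //; [lra | move=> x y; lra]. Qed.

Lemma sumR_opp (I : Type) (r : seq I) (Q : pred I) (F : I -> R) :
  \big[Rplus/0]_(i <- r | Q i) (- F i) = - \big[Rplus/0]_(i <- r | Q i) F i.
Proof.
by apply: (big_ind2 (fun x y => x = - y)) => // [|x1 x2 y1 y2 -> ->]; lra.
Qed.

Lemma sumR_sub (I : Type) (r : seq I) (Q : pred I) (F G : I -> R) :
  \big[Rplus/0]_(i <- r | Q i) (F i - G i) =
  \big[Rplus/0]_(i <- r | Q i) F i - \big[Rplus/0]_(i <- r | Q i) G i.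
Proof. by rewrite /Rminus -sumR_opp -big_split. Qed.

Lemma sumR_const (I : finType) (c : R) : \big[Rplus/0]_(i : I) c = INR #|I| * c.
Proof.
rewrite big_const; elim: #|I| => [|n IHn]; first by rewrite /=; lra.
by rewrite iterS IHn S_INR; lra.
Qed.

Lemma sumR_term (I : finType) (F : I -> R) (j : I) :
  (forall i, 0 <= F i) -> F j <= \Sum_i F i.
Proof.
move=> F0; rewrite (bigD1 j) //=.
have : 0 <= \big[Rplus/0]_(i | i != j) F i by apply: sumR_ge0.
lra.
Qed.

Lemma maxR_ub (I : finType) (x0 : R) (F : I -> R) (j : I) :
  F j <= \big[Rmax/x0]_i F i.
Proof.
have := mem_index_enum j; elim: (index_enum I) => // i r IHr.
rewrite in_cons big_cons => /orP[/eqP <-|/IHr le]; first exact: Rmax_l.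
exact: Rle_trans le (Rmax_r _ _).
Qed.

Lemma maxR_le (I : finType) (x0 c : R) (F : I -> R) :
  x0 <= c -> (forall i, F i <= c) -> \big[Rmax/x0]_i F i <= c.
Proof. by move=> x0c Fc; apply: (big_ind (fun z => z <= c)) => // x y; apply: Rmax_lub. Qed.

Lemma maxR_argmax (I : finType) (i0 j : I) (F : I -> R) :
  (forall i, F i <= F j) -> \big[Rmax/F i0]_i F i = F j.
Proof. by move=> Fj; apply: Rle_antisym; [apply: maxR_le | apply: maxR_ub]. Qed.

(** * Expectation under a distribution on a finite type *)

Definition Ex (X : finType) (q f : X -> R) : R := \Sum_y (q y * f y).

Lemma Ex_ext (X : finType) (q f g : X -> R) : f =1 g -> Ex q f = Ex q g.
Proof. by move=> fg; apply: eq_bigr => y _; rewrite fg. Qed.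

Lemma Ex_add (X : finType) (q f g : X -> R) :
  Ex q (fun y => f y + g y) = Ex q f + Ex q g.
Proof. by rewrite /Ex -big_split; apply: eq_bigr => y _ /=; lra. Qed.

Lemma Ex_sub (X : finType) (q f g : X -> R) :
  Ex q (fun y => f y - g y) = Ex q f - Ex q g.
Proof. by rewrite /Ex -sumR_sub; apply: eq_bigr => y _ /=; lra. Qed.

Lemma Ex_scale (X : finType) (q f : X -> R) (c : R) :
  Ex q (fun y => c * f y) = c * Ex q f.
Proof. by rewrite /Ex big_distrr; apply: eq_bigr => y _ /=; lra. Qed.

Section Distribution.
Variables (X : finType) (q : X -> R).
Hypotheses (q_ge0 : forall y, 0 <= q y) (q_sum : \Sum_y q y = 1).

Lemma Ex_le (f g : X -> R) : (forall y, f y <= g y) -> Ex q f <= Ex q g.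
Proof. by move=> fg; apply: sumR_le => y _; apply: Rmult_le_compat_l. Qed.

Lemma Ex_const (c : R) : Ex q (fun=> c) = c.
Proof. by rewrite /Ex -(big_distrl c) /= q_sum Rmult_1_l. Qed.

Lemma Ex_ge0 (f : X -> R) : (forall y, 0 <= f y) -> 0 <= Ex q f.
Proof. by move=> f0; rewrite -(Ex_const 0); apply: Ex_le. Qed.

End Distribution.

(** * Exponential moments *)

Lemma exp_le_inv (x : R) : x < 1 -> exp x <= / (1 - x).
Proof.
move=> x1; rewrite -[x in exp x]Ropp_involutive exp_Ropp.
apply: Rinv_le_contravar; first lra.
have [->|x0] := Req_dec x 0; first by rewrite Ropp_0 exp_0; lra.
have := exp_ineq1 (- x); lra.
Qed.

Lemma ln_mono (x y : R) : 0 < x -> x <= y -> ln x <= ln y.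
Proof. by move=> x0 [/(ln_increasing _ _ x0)|->]; lra. Qed.

Lemma exp_ge_1x (x : R) : 1 + x <= exp x.
Proof. exact: exp_ineq1_le. Qed.

(* Convexity of [exp]: tangent lines at [x], evaluated at [0] and at [1]. *)
Lemma exp_le_1_2x (x : R) : 0 <= x <= 1 -> exp x <= 1 + 2 * x.
Proof.
move=> [x0 x1]; have ex0 := exp_pos x.
have t0 : exp x * (1 - x) <= 1.
  have h := exp_ge_1x (- x).
  rewrite [X in _ <= X](_ : 1 = exp x * exp (- x)); last by rewrite -exp_plus Rplus_opp_r exp_0.
  by apply: Rmult_le_compat_l; lra.
have t1 : exp x * (2 - x) <= exp 1.
  have h := exp_ge_1x (1 - x).
  have -> : exp 1 = exp x * exp (1 - x) by rewrite -exp_plus; f_equal; lra.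
  by apply: Rmult_le_compat_l; lra.
(* Weighting [t0] by [1 - x] and [t1] by [x] leaves exactly [exp x] on the left, since
   [(1 - x)^2 + x (2 - x) = 1]; on the right it gives [(1 - x) + 3 x]. *)
have := exp_le_3; nra.
Qed.

Lemma exp_le_quad (x : R) : x <= 1 -> exp x <= 1 + x + x ^ 2.
Proof.
move=> x1; have [x_le0|x_gt0] := Rle_lt_dec x 0.
  apply: Rle_trans (_ : / (1 - x) <= _); first by apply: exp_le_inv; lra.
  (* For [x <= 0], [(1 + x + x^2) (1 - x) = 1 - x^3 >= 1]. Positive [x] is treated below by the mean
     value theorem. *)
  apply: (Rmult_le_reg_r (1 - x)); first lra.
  rewrite Rinv_l; last lra.
  nra.
pose f y := 1 + y + y ^ 2 - exp y; pose f' y := 1 + 2 * y - exp y.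
have df y : 0 <= y <= x -> derivable_pt_lim f y (f' y).
  move=> _; rewrite /f /f'.
  apply: derivable_pt_lim_minus; last exact: derivable_pt_lim_exp.
  have -> : 1 + 2 * y = (0 + 1) + INR 2 * y ^ 1 by rewrite /=; lra.
  apply: derivable_pt_lim_plus; last exact: derivable_pt_lim_pow.
  apply: derivable_pt_lim_plus; last exact: derivable_pt_lim_id.
  exact: derivable_pt_lim_const.
have [c [] ] := MVT_cor2 f f' 0 x x_gt0 df.
rewrite /f /f' exp_0 => eq_f c_in.
have := @exp_le_1_2x c; nra.
Qed.

(** In [exp Y <= 1 + Y + Y^2] the linear term has mean zero and the quadratic one is at most [v], so
    the mean is at most [1 + v <= exp v]. *)
Lemma chernoff_centered (X : finType) (q Y : X -> R) (v : R) :
  (forall y, 0 <= q y) -> \Sum_y q y = 1 -> Ex q Y = 0 ->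
  (forall y, Rabs (Y y) <= 1) -> (forall y, Y y ^ 2 <= v) ->
  Ex q (fun y => exp (Y y - v)) <= 1.
Proof.
move=> q0 q1 EY Y1 Yv.
have -> : Ex q (fun y => exp (Y y - v)) = exp (- v) * Ex q (fun y => exp (Y y)).
  by rewrite -Ex_scale; apply: Ex_ext => y; rewrite -exp_plus; f_equal; lra.
have le : Ex q (fun y => exp (Y y)) <= exp v.
  apply: Rle_trans (_ : Ex q (fun y => (1 + v) + Y y) <= _).
    apply: Ex_le => // y; have := Yv y; have := Y1 y.
    by move=> /(Rle_trans _ _ _ (Rle_abs _)) /exp_le_quad; lra.
  rewrite Ex_add Ex_const // EY; have := exp_ge_1x v; lra.
have -> : 1 = exp (- v) * exp v by rewrite -exp_plus Rplus_opp_l exp_0.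
by apply: Rmult_le_compat_l le; apply/Rlt_le/exp_pos.
Qed.

(** The exponential of an indicator is affine in it, so the compensator is proportional to [q y0]
    itself. This is what makes the resulting bound multiplicative. *)
Lemma chernoff_indicator (X : finType) (q : X -> R) (y0 : X) (lam : R) :
  (forall y, 0 <= q y) -> \Sum_y q y = 1 -> 0 <= lam <= 1 ->
  Ex q (fun y => exp (lam * INR (y == y0) - lam * (1 + lam) * q y0)) <= 1.
Proof.
move=> q0 q1 lam01; set v := lam * (1 + lam) * q y0.
have -> : Ex q (fun y => exp (lam * INR (y == y0) - v)) =
          exp (- v) * Ex q (fun y => exp (lam * INR (y == y0))).
  by rewrite -Ex_scale; apply: Ex_ext => y; rewrite -exp_plus; f_equal; lra.
have le : Ex q (fun y => exp (lam * INR (y == y0))) <= exp v.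
  apply: Rle_trans (exp_ge_1x v).
  apply: Rle_trans (_ : Ex q (fun y => 1 + (lam + lam ^ 2) * INR (y == y0)) <= _).
    apply: Ex_le => // y; case: (y == y0) => /=.
      by rewrite !Rmult_1_r; have := @exp_le_quad lam; lra.
    by rewrite !Rmult_0_r exp_0; lra.
  rewrite Ex_add Ex_const // Ex_scale /Ex (bigD1 y0) //= big1 => [|y /negbTE->].
    by rewrite eqxx /= /v; lra.
  by rewrite /= Rmult_0_r.
have -> : 1 = exp (- v) * exp v by rewrite -exp_plus Rplus_opp_l exp_0.
by apply: Rmult_le_compat_l le; apply/Rlt_le/exp_pos.
Qed.

(* The loss factor [1 + lam] pays for the second-order term of [exp (- u)]. *)
Lemma chernoff_nonneg (X : finType) (q D : X -> R) (lam s : R) :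
  (forall y, 0 <= q y) -> \Sum_y q y = 1 -> 0 <= lam -> 0 <= s ->
  (forall y, 0 <= D y) ->
  (forall y, s * (1 + lam) ^ 2 * D y <= lam) ->
  Ex q (fun y => exp (s * (Ex q D - (1 + lam) * D y))) <= 1.
Proof.
move=> q0 q1 lam0 s0 D0 sD; set m := Ex q D.
pose u y := s * (1 + lam) * D y.
have u0 y : 0 <= u y by apply: Rmult_le_pos => //; apply: Rmult_le_pos; lra.
have -> : Ex q (fun y => exp (s * (m - (1 + lam) * D y))) =
          exp (s * m) * Ex q (fun y => exp (- u y)).
  by rewrite -Ex_scale; apply: Ex_ext => y; rewrite -exp_plus /u; f_equal; lra.
have le : Ex q (fun y => exp (- u y)) <= exp (- (s * m)).
  apply: Rle_trans (exp_ge_1x _).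
  apply: Rle_trans (_ : Ex q (fun y => 1 - s * D y) <= _).
    apply: Ex_le => // y; have uy0 := u0 y; have := @exp_le_quad (- u y).
    have u2_le : u y ^ 2 <= u y - s * D y.
      have -> : u y - s * D y = s * D y * lam by rewrite /u; lra.
      have -> : u y ^ 2 = s * D y * (s * (1 + lam) ^ 2 * D y) by rewrite /u; ring.
      by apply: Rmult_le_compat_l (sD y); apply: Rmult_le_pos.
    by lra.
  by rewrite Ex_sub Ex_const // Ex_scale /m; lra.
have -> : 1 = exp (s * m) * exp (- (s * m)) by rewrite -exp_plus Rplus_opp_r exp_0.
by apply: Rmult_le_compat_l le; apply/Rlt_le/exp_pos.
Qed.

(** * Supermartingales along episodes *)

Section Episodes.
Variables (X Ac : finType) (P : X -> Ac -> X -> R).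
Hypotheses (P_ge0 : forall x a y, 0 <= P x a y)
           (P_sum : forall x a, \Sum_y P x a y = 1).
Implicit Types (pol : X -> nat -> Ac) (tr : seq (transition X Ac)).
Implicit Types (hist : seq (seq (transition X Ac))).

(** The support of [ep_exp]: traces that chain states and follow the policy, whatever their
    probability. *)
Fixpoint valid_ep pol (n h : nat) (x : X) tr : Prop :=
  match n, tr with
  | 0, [::] => True
  | n'.+1, t :: tr' => t.1 = (x, pol x h) /\ valid_ep pol n' h.+1 t.2 tr'
  | _, _ => False
  end.

Lemma valid_ep_size pol n h x tr : valid_ep pol n h x tr -> size tr = n.
Proof. by elim: n h x tr => [|n IHn] h x [|t tr] //= [_ /IHn ->]. Qed.

Lemma ep_exp_step pol n h x g :
  ep_exp P pol n.+1 h x g =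
  Ex (P x (pol x h)) (fun y =>
    ep_exp P pol n h.+1 y (fun tr => g ((x, pol x h, y) :: tr))).
Proof. by []. Qed.

Lemma ep_exp_le pol n h x g1 g2 :
  (forall tr, valid_ep pol n h x tr -> g1 tr <= g2 tr) ->
  ep_exp P pol n h x g1 <= ep_exp P pol n h x g2.
Proof.
elim: n h x g1 g2 => [|n IHn] h x g1 g2 le_g; first exact: le_g.
by rewrite !ep_exp_step; apply: Ex_le => // y; apply: IHn => tr ?; apply: le_g.
Qed.

Lemma ep_exp_ext pol n h x g1 g2 : g1 =1 g2 ->
  ep_exp P pol n h x g1 = ep_exp P pol n h x g2.
Proof.
by move=> eg; apply: Rle_antisym; apply: ep_exp_le => tr _; rewrite eg; lra.
Qed.

Lemma ep_exp_const pol n h x c : ep_exp P pol n h x (fun=> c) = c.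
Proof.
elim: n h x => [|n IHn] h x //; rewrite ep_exp_step -[RHS](Ex_const (P_sum x (pol x h))).
by apply: Ex_ext => y; apply: IHn.
Qed.

Lemma ep_exp_scale pol n h x c g :
  ep_exp P pol n h x (fun tr => c * g tr) = c * ep_exp P pol n h x g.
Proof.
elim: n h x g => [|n IHn] h x g //; rewrite !ep_exp_step -Ex_scale.
by apply: Ex_ext => y; apply: IHn.
Qed.

Lemma ep_exp_add pol n h x g1 g2 :
  ep_exp P pol n h x (fun tr => g1 tr + g2 tr) =
  ep_exp P pol n h x g1 + ep_exp P pol n h x g2.
Proof.
elim: n h x g1 g2 => [|n IHn] h x g1 g2 //; rewrite !ep_exp_step -Ex_add.
by apply: Ex_ext => y; apply: IHn.
Qed.

Lemma ep_exp_sum (I : finType) pol n h x (g : I -> seq (transition X Ac) -> R) :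
  ep_exp P pol n h x (fun tr => \Sum_i g i tr) = \Sum_i ep_exp P pol n h x (g i).
Proof.
elim: (index_enum I) => [|i r IHr].
  by rewrite big_nil -[RHS](ep_exp_const pol n h x); apply: ep_exp_ext => tr; rewrite big_nil.
rewrite big_cons -IHr -ep_exp_add; apply: ep_exp_ext => tr; by rewrite big_cons.
Qed.

Fixpoint ep_weight (z : nat -> transition X Ac -> R) (h : nat) tr : R :=
  if tr is t :: tr' then z h t + ep_weight z h.+1 tr' else 0.

Lemma ep_weight_const z h tr :
  ep_weight (fun=> z) h tr = \big[Rplus/0]_(t <- tr) z t.
Proof. by elim: tr h => [|t tr IH] h; rewrite ?big_nil // big_cons -(IH h.+1). Qed.

(** Tower property: conditionally on the first transition the remaining product has mean at most
    [1], and so does the first factor. *)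
Lemma ep_weight_exp_le1 pol n h x z :
  (forall h' x', (h <= h' < h + n)%N ->
     Ex (P x' (pol x' h')) (fun y => exp (z h' (x', pol x' h', y))) <= 1) ->
  ep_exp P pol n h x (fun tr => exp (ep_weight z h tr)) <= 1.
Proof.
elim: n h x => [|n IHn] h x z_le; first by rewrite /= exp_0; lra.
rewrite ep_exp_step; apply: Rle_trans (z_le h x _); last by rewrite leqnn -addSnnS leq_addr.
apply: Ex_le => // y.
rewrite (@ep_exp_ext _ _ _ _ _ (fun tr => exp (z h (x, pol x h, y)) * exp (ep_weight z h.+1 tr))).
  rewrite ep_exp_scale -[X in _ <= X]Rmult_1_r.
  apply: Rmult_le_compat_l; first exact/Rlt_le/exp_pos.
  by apply: IHn => h' x' /andP[hh' h'n]; apply: z_le; rewrite ltnW //= -addSnnS.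
by move=> tr /=; rewrite exp_plus.
Qed.

(** * Whole runs: maximal inequality and simultaneous deviation bounds *)

Section Run.
Variables (H : nat) (agent : seq (seq (transition X Ac)) -> X -> nat -> Ac).
Variable init : seq (seq (transition X Ac)) -> X.

Definition valid_run hist : Prop :=
  forall k, (k < size hist)%N ->
    valid_ep (agent (take k hist)) H 1 (init (take k hist)) (nth [::] hist k).

Lemma take_rcons_le (T : Type) (s : seq T) t j :
  (j <= size s)%N -> take j (rcons s t) = take j s.
Proof. by move=> js; rewrite -cats1 takel_cat. Qed.

Lemma valid_run_rcons hist tr : valid_run hist ->
  valid_ep (agent hist) H 1 (init hist) tr -> valid_run (rcons hist tr).
Proof.
move=> vh vtr k; rewrite size_rcons ltnS leq_eqVlt nth_rcons => /orP[/eqP->|lt_k].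
  by rewrite ltnn eqxx take_rcons_le // take_size.
by rewrite lt_k take_rcons_le 1?ltnW //; apply: vh.
Qed.

Lemma run_exp_ge0 k hist f : (forall h, 0 <= f h) ->
  0 <= run_exp P H agent init k hist f.
Proof.
move=> f0; elim: k hist => [|k IHk] hist //=.
rewrite -[X in X <= _](ep_exp_const (agent hist) H 1 (init hist)).
by apply: ep_exp_le.
Qed.

Lemma valid_run_sizes hist tr : valid_run hist -> tr \in hist -> size tr = H.
Proof.
move=> vh tr_in; have := vh (index tr hist).
by rewrite index_mem nth_index // => /(_ tr_in) /valid_ep_size.
Qed.

Lemma valid_run_size_flatten hist :
  valid_run hist -> size (flatten hist) = (size hist * H)%N.
Proof.
move=> vh; rewrite size_flatten -[in RHS](size_map size) -/(shape hist).
have : all (pred1 H) (shape hist).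
  by apply/allP => _ /mapP[tr /(valid_run_sizes vh) <- ->] /=.
by move=> /all_pred1P ->; rewrite size_nseq sumn_nseq mulnC.
Qed.

(* Ville's maximal inequality, with a stopping rule at level [1]. *)
Lemma ville (M f : seq (seq (transition X Ac)) -> R) (K : nat) :
  (forall hist, ep_exp P (agent hist) H 1 (init hist) (fun tr => M (rcons hist tr)) <= M hist) ->
  (forall hist, 0 <= M hist) -> (forall hist, 0 <= f hist) ->
  (forall hist, size hist = K -> valid_run hist ->
     (forall j, (j <= K)%N -> M (take j hist) <= 1) -> 1 <= f hist) ->
  1 - M [::] <= run_exp P H agent init K [::] f.
Proof.
move=> M_super M0 f0 f1.
suff gen k hist : (size hist + k)%N = K -> valid_run hist ->
    (forall j, (j < size hist)%N -> M (take j hist) <= 1) ->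
    1 - M hist <= run_exp P H agent init k hist f by apply: gen.
(* Stopping: once [M hist] exceeds [1], the left side is negative and nonnegativity of [f]
   suffices. *)
have [M_gt|M_le] := Rlt_le_dec 1 (M hist).
  by move=> _ _ _; apply: Rle_trans (run_exp_ge0 _ _ f0); lra.
elim: k hist M_le => [|k IHk] hist M_le size_h vh M1.
  apply: Rle_trans (_ : 1 <= _); first by have := M0 hist; lra.
  apply: f1 => //; first by rewrite -size_h addn0.
  move=> j; rewrite -size_h addn0 leq_eqVlt => /orP[/eqP->|/M1 //].
  by rewrite take_size.
rewrite /=; apply: Rle_trans (_ : 1 - ep_exp P (agent hist) H 1 (init hist)
  (fun tr => M (rcons hist tr)) <= _); first by have := M_super hist; lra.
rewrite [X in X <= _](_ : _ = ep_exp P (agent hist) H 1 (init hist)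
  (fun tr => 1 + -1 * M (rcons hist tr))).
  apply: ep_exp_le => tr vtr.
  have [M_gt|M_le'] := Rlt_le_dec 1 (M (rcons hist tr)).
    by apply: Rle_trans (run_exp_ge0 _ _ f0); lra.
  apply: Rle_trans (IHk (rcons hist tr) M_le' _ _ _); first lra.
  - by rewrite size_rcons addSnnS.
  - exact: valid_run_rcons.
  move=> j; rewrite size_rcons ltnS => le_j; rewrite take_rcons_le //.
  by move: le_j; rewrite leq_eqVlt => /orP[/eqP->|/M1 //]; rewrite take_size.
by rewrite ep_exp_add ep_exp_const ep_exp_scale; lra.
Qed.

(** The weight [z] sees only the episodes before the current one, so it is predictable at the
    episode level. *)
Definition run_weight (z : seq (seq (transition X Ac)) -> nat -> transition X Ac -> R) hist : R :=
  \big[Rplus/0]_(k < size hist) ep_weight (z (take k hist)) 1 (nth [::] hist k).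

Lemma run_weight_rcons z hist tr :
  run_weight z (rcons hist tr) = run_weight z hist + ep_weight (z hist) 1 tr.
Proof.
rewrite /run_weight size_rcons big_ord_recr /= nth_rcons ltnn eqxx.
rewrite take_rcons_le // take_size; congr (_ + _).
by apply: eq_bigr => k _; rewrite nth_rcons ltn_ord take_rcons_le // ltnW.
Qed.

Lemma run_weight_const z hist :
  run_weight (fun _ _ => z) hist = \big[Rplus/0]_(t <- flatten hist) z t.
Proof.
elim/last_ind: hist => [|hist tr IH]; first by rewrite /run_weight big_ord0 big_nil.
by rewrite run_weight_rcons IH ep_weight_const flatten_rcons big_cat.
Qed.

(** The mixture [M] of the exponential supermartingales with weights [p i] starts below [delta].
    While [M <= 1], each of its nonnegative terms is at most [1], which bounds every exponent at
    every time: the union bound is built into [M]. *)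
Lemma exponential_deviation (I : finType) (p : I -> R)
    (z : I -> seq (seq (transition X Ac)) -> nat -> transition X Ac -> R)
    (delta : R) (K : nat) (f : seq (seq (transition X Ac)) -> R) :
  (forall i, 0 < p i) -> \Sum_i p i <= delta ->
  (forall i hist h x, (1 <= h <= H)%N ->
     Ex (P x (agent hist x h)) (fun y => exp (z i hist h (x, agent hist x h, y))) <= 1) ->
  (forall hist, 0 <= f hist) ->
  (forall hist, size hist = K -> valid_run hist ->
     (forall i j, (j <= K)%N -> run_weight (z i) (take j hist) <= ln (/ p i)) ->
     1 <= f hist) ->
  1 - delta <= run_exp P H agent init K [::] f.
Proof.
move=> p0 p_sum z_le f0 f1; pose M hist := \Sum_i (p i * exp (run_weight (z i) hist)).
have term0 i hist : 0 <= p i * exp (run_weight (z i) hist).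
  by apply: Rmult_le_pos; [apply/Rlt_le | apply/Rlt_le/exp_pos].
apply: Rle_trans (_ : 1 - M [::] <= _).
  rewrite (_ : M [::] = \Sum_i p i); first lra.
  by apply: eq_bigr => i _; rewrite /run_weight big_ord0 exp_0 Rmult_1_r.
apply: ville => // [hist|hist|hist size_h vh M1]; last first.
- apply: f1 => // i j jK; have := Rle_trans _ _ _ (sumR_term i _) (M1 j jK).
  move=> /(_ (fun i' => term0 i' _)) le1.
  rewrite -[X in X <= _]ln_exp; apply: ln_mono; first exact: exp_pos.
  apply: (Rmult_le_reg_l (p i)) => //; rewrite Rinv_r //.
  exact/Rgt_not_eq.
- exact: sumR_ge0.
rewrite /M ep_exp_sum; apply: sumR_le => i _.
rewrite (@ep_exp_ext _ _ _ _ _ (fun tr => p i * exp (run_weight (z i) hist) *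
                                     exp (ep_weight (z i hist) 1 tr))).
  rewrite ep_exp_scale -[X in _ <= X]Rmult_1_r; apply: Rmult_le_compat_l => //.
  by apply: ep_weight_exp_le1 => h x; rewrite add1n ltnS; apply: z_le.
by move=> tr; rewrite run_weight_rcons exp_plus Rmult_assoc.
Qed.

End Run.
End Episodes.

(** * Visit counts *)

Lemma INR_leq (m n : nat) : (m <= n)%N -> INR m <= INR n.
Proof. by move=> /leP /le_INR. Qed.

Lemma INR_gt0 (n : nat) : (0 < n)%N -> 0 < INR n.
Proof. by move=> /ltP /lt_0_INR. Qed.

Lemma INR_ge1 (n : nat) : (0 < n)%N -> 1 <= INR n.
Proof. exact: (@INR_leq 1). Qed.

Section Counts.
Variables (X Ac : finType).
Implicit Types (hs tr : seq (transition X Ac)) (s : X * Ac).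

Definition visit (x : X) (a : Ac) (t : transition X Ac) : bool :=
  (t.1.1 == x) && (t.1.2 == a).

Lemma N2_cat hs tr x a : N2 (hs ++ tr) x a = (N2 hs x a + N2 tr x a)%N.
Proof. exact: count_cat. Qed.

Lemma sum_visits_next hs x a (f : X -> R) :
  \big[Rplus/0]_(t <- hs) (if visit x a t then f t.2 else 0) =
  \Sum_y (INR (N3 hs x a y) * f y).
Proof.
elim: hs => [|[[x' a'] y'] hs IH].
  by rewrite big_nil big1 // => y _ /=; rewrite Rmult_0_l.
rewrite big_cons IH /visit /= {IH}.
under [in RHS]eq_bigr => y _ do rewrite plus_INR Rmult_plus_distr_r.
rewrite big_split /=; congr (_ + _).
rewrite (bigD1 y') //= big1 => [|y /negbTE yy'].
  by rewrite !xpair_eqE eqxx andbT; case: ifP => _ /=; lra.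
by rewrite !xpair_eqE [y' == y]eq_sym yy' andbF /=; lra.
Qed.

Lemma sum_visits_const hs x a (c : R) :
  \big[Rplus/0]_(t <- hs) (if visit x a t then c else 0) = INR (N2 hs x a) * c.
Proof.
elim: hs => [|t hs IH]; first by rewrite big_nil /=; lra.
by rewrite big_cons IH /N2 /= plus_INR -/(visit x a t); case: visit => /=; lra.
Qed.

Lemma sum_N3 hs x a : \Sum_y INR (N3 hs x a y) = INR (N2 hs x a).
Proof.
rewrite -[RHS]Rmult_1_r -sum_visits_const (sum_visits_next hs x a (fun=> 1)).
by apply: eq_bigr => y _; rewrite Rmult_1_r.
Qed.

Lemma sum_transitions hs (f : X * Ac -> R) :
  \big[Rplus/0]_(t <- hs) f t.1 = \Sum_s (INR (N2 hs s.1 s.2) * f s).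
Proof.
elim: hs => [|[[x a] y] hs IH].
  by rewrite big_nil big1 // => s _ /=; rewrite Rmult_0_l.
rewrite big_cons IH /=.
under [in RHS]eq_bigr => s _ do rewrite plus_INR Rmult_plus_distr_r.
rewrite big_split /=; congr (_ + _).
rewrite (bigD1 (x, a)) //= big1 => [|[x' a']]; first by rewrite !eqxx /=; lra.
by rewrite eq_sym xpair_eqE => /negbTE /= ->; exact: Rmult_0_l.
Qed.

Lemma sum_N2 hs : \Sum_s INR (N2 hs s.1 s.2) = INR (size hs).
Proof.
transitivity (\big[Rplus/0]_(t <- hs) 1).
  rewrite (sum_transitions hs (fun=> 1)).
  by apply: eq_bigr => s _; rewrite Rmult_1_r.
elim: hs => [|t hs IH]; first by rewrite big_nil.
by rewrite big_cons IH -[size (t :: hs)]/(size hs).+1 S_INR; lra.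
Qed.

Lemma N2_le_size hs x a : (N2 hs x a <= size hs)%N.
Proof. exact: count_size. Qed.

Definition Phat hs x a (y : X) : R := INR (N3 hs x a y) / INR (N2 hs x a).

Lemma Phat_ge0 hs x a y : (0 < N2 hs x a)%N -> 0 <= Phat hs x a y.
Proof. by move=> N0; apply: Rle_mult_inv_pos; [exact: pos_INR | exact: INR_gt0]. Qed.

Lemma Phat_sum hs x a : (0 < N2 hs x a)%N -> \Sum_y Phat hs x a y = 1.
Proof.
move=> /INR_gt0 N0; rewrite /Phat /Rdiv -(big_distrl (/ INR (N2 hs x a))) /= sum_N3.
by rewrite Rinv_r //; lra.
Qed.

End Counts.

(** * Optimism and the one-step regret recursion *)

Section MDP.
Variables (X Ac : finType) (a0 : Ac) (P : X -> Ac -> X -> R) (rew : X -> Ac -> R) (H : nat).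
Hypotheses (P_ge0 : forall x a y, 0 <= P x a y)
           (P_sum : forall x a, \Sum_y P x a y = 1)
           (rew01 : forall x a, 0 <= rew x a <= 1) (H_gt0 : (1 <= H)%N).
Implicit Types (hs tr : seq (transition X Ac)) (hist : seq (seq (transition X Ac))).
Implicit Types (pol : X -> nat -> Ac).

(* [Wopt (H.+1 - h)] is the optimal value at step [h]: [rew] and [P] do not depend on the step. *)
Fixpoint Wopt (m : nat) (x : X) : R :=
  if m is m'.+1 then
    \big[Rmax/rew x a0 + Ex (P x a0) (Wopt m')]_a (rew x a + Ex (P x a) (Wopt m'))
  else 0.

Lemma Wopt_bounds m x : 0 <= Wopt m x <= INR m.
Proof.
elim: m x => [|m IHm] x; first by rewrite /=; lra.
have step a : 0 <= rew x a + Ex (P x a) (Wopt m) <= INR m.+1.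
  have := rew01 x a; rewrite S_INR.
  have : 0 <= Ex (P x a) (Wopt m) by apply: Ex_ge0 => // y; case: (IHm y).
  have : Ex (P x a) (Wopt m) <= INR m.
    by rewrite -[INR m](Ex_const (P_sum x a)); apply: Ex_le => // y; case: (IHm y).
  lra.
split; last by apply: maxR_le => [|a]; [have [] := step a0 | have [] := step a].
by apply: Rle_trans (maxR_ub _ _ a0); case: (step a0).
Qed.

Lemma Vpi_aux_ge0 pol m h x : 0 <= Vpi_aux P rew pol m h x.
Proof.
elim: m h x => [|m IHm] h x; first by rewrite /=; lra.
have [r0 _] := rew01 x (pol x h).
have : 0 <= Ex (P x (pol x h)) (Vpi_aux P rew pol m h.+1) by apply: Ex_ge0.
by rewrite /= /Ex; lra.
Qed.

Lemma Vpi_aux_le_Wopt pol m h x : Vpi_aux P rew pol m h x <= Wopt m x.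
Proof.
elim: m h x => [|m IHm] h x; first by rewrite /=; lra.
apply: Rle_trans (maxR_ub _ _ (pol x h)); apply: Rplus_le_compat_l.
exact: Ex_le.
Qed.

Lemma Vstar_le_Wopt h x : Vstar P rew H a0 h x <= Wopt (H.+1 - h) x.
Proof. by apply: maxR_le => [|f]; apply: Vpi_aux_le_Wopt. Qed.

Variable b : nat -> R.

Local Notation Q := (Qfun a0 rew H b).
(** Index shift: [VQ j.+1] is computed from the first [j] episodes, hence is the value used in the
    episode that follows them; [VQ 0] is the constant [H]. *)
Definition VQ (j : nat) hist (h : nat) (x : X) : R :=
  \big[Rmax/Q j hist h x a0]_a Q j hist h x a.

Lemma Q_step j hist h x a : (1 <= h <= H)%N ->
  Q j.+1 hist h x a =
  let hs := flatten (take j hist) in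
  if (0 < N2 hs x a)%N then
    Rmin (Q j hist h x a)
      (Rmin (INR H) (rew x a + Ex (Phat hs x a) (VQ j.+1 hist h.+1) + b (N2 hs x a)))
  else INR H.
Proof. by move=> /andP[_ hH] /=; rewrite subSn. Qed.

Lemma Q_le_H j hist h x a : Q j hist h x a <= INR H.
Proof.
case: j => [|j] /=; first lra.
case: (H.+1 - h)%N => [|m] /=; first exact: pos_INR.
case: ifP => _; last lra.
by apply: Rle_trans (Rmin_r _ _) _; apply: Rmin_l.
Qed.

Lemma VQ_le_H j hist h x : VQ j hist h x <= INR H.
Proof. by apply: maxR_le => [|a]; apply: Q_le_H. Qed.

Lemma VQ_end j hist x : VQ j.+1 hist H.+1 x = 0.
Proof.
have Q0 a : Q j.+1 hist H.+1 x a = 0 by rewrite /= subnn.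
by rewrite /VQ (@maxR_argmax _ a0 a0) // => a; rewrite !Q0; lra.
Qed.

Variables (L lam l2 beta : R).
Hypotheses (lam_gt0 : 0 < lam) (l2_ge0 : 0 <= l2) (beta_ge0 : 0 <= beta).

(** The tested function [Wopt m] is deterministic, unlike the value estimates, so a Hoeffding bound
    applies to it directly. *)
Definition value_concentration hs : Prop :=
  forall x a m, (m < H)%N -> (0 < N2 hs x a)%N ->
  Rabs (Ex (Phat hs x a) (Wopt m) - Ex (P x a) (Wopt m)) <=
  2 * INR H * sqrt (L / INR (N2 hs x a)).

(** Stated after multiplication by the visit count, so that unvisited pairs are covered too. *)
Definition count_concentration hs : Prop :=
  forall x a y,
  INR (N3 hs x a y) <= (1 + lam) * P x a y * INR (N2 hs x a) + l2 / lam.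

Hypothesis b_optimistic : forall n, (0 < n)%N -> 2 * INR H * sqrt (L / INR n) <= b n.

Lemma VQ_optimistic_of_Q j hist h :
  (h <= H)%N ->
  (forall x a, rew x a + Ex (P x a) (Wopt (H - h)) <= Q j hist h x a) ->
  forall x, Wopt (H.+1 - h) x <= VQ j hist h x.
Proof.
move=> hH Q_opt x; rewrite subSn //.
by apply: maxR_le => [|a]; apply: Rle_trans (Q_opt _ _) _; apply: maxR_ub.
Qed.

(** Two nested inductions: over episodes, because of the minimum with the previous [Q], and backward
    over steps, because of the next value. The bonus covers the error of [Phat] on [Wopt]. *)
Lemma Q_optimistic j hist h x a : (1 <= h <= H)%N ->
  (forall i, (i < j)%N -> value_concentration (flatten (take i hist))) ->
  rew x a + Ex (P x a) (Wopt (H - h)) <= Q j hist h x a.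
Proof.
move=> hH conc; elim: j h x a hH conc => [|j IHj] h x a hH conc.
  case/andP: hH => h1 hH; have [_ r1] := rew01 x a.
  have : Ex (P x a) (Wopt (H - h)) <= INR (H - 1).
    rewrite -[INR _](Ex_const (P_sum x a)); apply: Ex_le => // y.
    case: (Wopt_bounds (H - h) y) => _ /Rle_trans; apply.
    by apply: INR_leq; apply: leq_sub2l.
  by rewrite /= minus_INR; [rewrite /=; lra | apply/leP].
have Q_j h' x' a' : (1 <= h' <= H)%N ->
    rew x' a' + Ex (P x' a') (Wopt (H - h')) <= Q j hist h' x' a'.
  by move=> h'H; apply: IHj => // i /ltnW; apply: conc.
have [m] := ubnP (H - h)%N; elim: m => // m IHm in h x a hH *; rewrite ltnS => le_m.
have V_next y : Wopt (H - h) y <= VQ j.+1 hist h.+1 y.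
  case/andP: (hH) => h1; rewrite leq_eqVlt => /orP[/eqP->|lt_hH].
    by rewrite VQ_end subnn /=; lra.
  rewrite -subSS; apply: VQ_optimistic_of_Q => // x' a'; apply: IHm => //.
  by apply: leq_trans le_m; rewrite subnS prednK // subn_gt0.
rewrite Q_step //=; case: ifP => N0; last first.
  (* At an unvisited pair the new value is [H], which dominates the previous [Q], already
     optimistic. *)
  case/andP: hH => h1 hH; apply: Rle_trans (Q_j h x a _) (Q_le_H j hist h x a).
  by rewrite h1.
apply: Rmin_glb; first exact: Q_j.
apply: Rmin_glb; first exact: Rle_trans (Q_j h x a hH) (Q_le_H j hist h x a).
have lt_mH : (H - h < H)%N by case/andP: hH => h1 _; rewrite ltn_subrL h1.
have := conc j (ltnSn j) x a _ lt_mH N0 => /Rle_trans /(_ (b_optimistic N0)).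
set hs := flatten _ in N0 *.
have : Ex (Phat hs x a) (Wopt (H - h)) <= Ex (Phat hs x a) (VQ j.+1 hist h.+1).
  by apply: Ex_le V_next => y; apply: Phat_ge0.
have := Rle_abs (- (Ex (Phat hs x a) (Wopt (H - h)) - Ex (P x a) (Wopt (H - h)))).
by rewrite Rabs_Ropp; lra.
Qed.

Lemma VQ_optimistic j hist h x : (1 <= h <= H.+1)%N ->
  (forall i, (i <= j)%N -> value_concentration (flatten (take i hist))) ->
  Wopt (H.+1 - h) x <= VQ j.+1 hist h x.
Proof.
move=> /andP[h1]; rewrite leq_eqVlt => /orP[/eqP->|lt_hH] conc.
  by rewrite VQ_end subnn /=; lra.
apply: VQ_optimistic_of_Q => // x' a'; apply: Q_optimistic => //.
by rewrite h1.
Qed.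

(* Cost of one step at a pair visited [n] times: the trivial bound [H] until [n >= H],
   which absorbs the fact that counts are updated only between episodes. *)
Definition step_cost (n : nat) : R :=
  if (n < H)%N then INR H
  else beta / sqrt (INR n) + INR #|X| * INR H * l2 / lam / INR n.

Lemma step_cost_ge0 n : 0 <= step_cost n.
Proof.
rewrite /step_cost; case: ltnP => Hn; first exact: pos_INR.
have n0 : 0 < INR n by apply: INR_gt0; apply: leq_trans Hn.
apply: Rplus_le_le_0_compat; apply: Rle_mult_inv_pos => //; first exact: sqrt_lt_R0.
apply: Rle_mult_inv_pos => //; apply: Rmult_le_pos => //.
by apply: Rmult_le_pos; apply: pos_INR.
Qed.

(** Since [E] is nonnegative, the pointwise bound on [Phat] can be multiplied by it. The excess
    [lam P E] is dominated through [D], and the additive errors cost at most [H] times each, over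
    [#|X|] states. *)
Lemma count_concentration_Ex hs x a (E D : X -> R) (N0 : (0 < N2 hs x a)%N) :
  count_concentration hs -> (forall y, 0 <= E y <= INR H) -> (forall y, E y <= D y) ->
  Ex (Phat hs x a) E - Ex (P x a) E <=
  lam * Ex (P x a) D + INR #|X| * INR H * l2 / lam / INR (N2 hs x a).
Proof.
move=> conc EH ED; have n0 := INR_gt0 N0; set n := INR _ in n0 *.
have term y : Phat hs x a y * E y - P x a y * E y <=
    lam * (P x a y * D y) + INR H * l2 / lam / n.
  have le : Phat hs x a y <= (1 + lam) * P x a y + l2 / lam / n.
    apply: (Rmult_le_reg_r n) => //; rewrite /Phat -/n.
    have -> : INR (N3 hs x a y) / n * n = INR (N3 hs x a y) by field; lra.
    have -> : ((1 + lam) * P x a y + l2 / lam / n) * n =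
              (1 + lam) * P x a y * n + l2 / lam by field; lra.
    exact: conc.
  have c0 : 0 <= l2 / lam / n by apply: Rle_mult_inv_pos => //; apply: Rle_mult_inv_pos.
  have := EH y; have := ED y; have := P_ge0 x a y.
  have -> : INR H * l2 / lam / n = l2 / lam / n * INR H by field; lra.
  move: (l2 / lam / n) c0 le => c c0 le p0 eD [e0 eH].
  have h1 : Phat hs x a y * E y <= ((1 + lam) * P x a y + c) * E y.
    exact: Rmult_le_compat_r.
  have h2 : c * E y <= c * INR H by apply: Rmult_le_compat_l.
  have h3 : lam * P x a y * E y <= lam * P x a y * D y.
    by apply: Rmult_le_compat_l eD; apply: Rmult_le_pos p0; lra.
  lra.
rewrite /Ex -sumR_sub; apply: Rle_trans (sumR_le _ (fun y _ => term y)) _.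
rewrite big_split /= sumR_const -big_distrr /=.
by right; rewrite /Rdiv; ring.
Qed.

(** * The gap between the optimistic value and the value of the played policy *)

Variables (hist : seq (seq (transition X Ac))) (pol : X -> nat -> Ac).
Hypothesis pol_greedy : forall h x a, (1 <= h <= H)%N ->
  Qnext a0 rew H b hist h x a <= Qnext a0 rew H b hist h x (pol x h).

(** Clipping at [0] makes the gap nonnegative on every history, also where optimism fails, as the
    supermartingale property requires. *)
Definition gap (h : nat) (x : X) : R :=
  Rmax 0 (VQ (size hist).+1 hist h x - Vpi P rew H pol h x).

Lemma gap_ge0 h x : 0 <= gap h x. Proof. exact: Rmax_l. Qed.

Lemma gap_le_H h x : gap h x <= INR H.
Proof.
apply: Rmax_lub; first exact: pos_INR.
have : 0 <= Vpi P rew H pol h x by apply: Vpi_aux_ge0.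
by have := VQ_le_H (size hist).+1 hist h x; lra.
Qed.

Lemma gap_end x : gap H.+1 x = 0.
Proof. by rewrite /gap VQ_end /Vpi subnn /= Rmax_left; lra. Qed.

Hypothesis value_conc :
  forall i, (i <= size hist)%N -> value_concentration (flatten (take i hist)).
Hypothesis count_conc : count_concentration (flatten hist).
Hypothesis b_beta : forall n, (0 < n)%N ->
  b n + 2 * INR H * sqrt (L / INR n) <= beta / sqrt (INR n).

(** With [V], [W], [U] the optimistic, optimal and policy values at the next step, [Phat V - P U =
    (Phat - P) W + (Phat - P) (V - W) + P (V - U)]. The first term joins the bonus in
    [beta / sqrt n]; the second costs [lam P gap] and a term in [1 / n]. *)
Lemma gap_step h x : (1 <= h <= H)%N ->
  gap h x <= step_cost (N2 (flatten hist) x (pol x h)) +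
             (1 + lam) * Ex (P x (pol x h)) (gap h.+1).
Proof.
move=> hH; set a := pol x h; set n := N2 _ x a.
have g0 : 0 <= Ex (P x a) (gap h.+1) by apply: Ex_ge0 => // y; apply: gap_ge0.
have lg0 : 0 <= (1 + lam) * Ex (P x a) (gap h.+1) by apply: Rmult_le_pos; lra.
have c0 := step_cost_ge0 n.
case: (ltnP n H) => [lt_nH|le_Hn].
  by have := gap_le_H h x; rewrite /step_cost lt_nH; lra.
apply: Rmax_lub; first lra.
have n0 : (0 < n)%N by apply: leq_trans le_Hn.
have V_Q : VQ (size hist).+1 hist h x = Q (size hist).+1 hist h x a.
  by apply: maxR_argmax => a'; apply: pol_greedy.
rewrite V_Q Q_step //= take_size -/n n0 /step_cost ltnNge le_Hn /=.
have -> : Vpi P rew H pol h x = rew x a + Ex (P x a) (Vpi P rew H pol h.+1).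
  by case/andP: (hH) => _ h_le; rewrite /Vpi subSn.
set V := VQ _ _ h.+1; set U := Vpi P rew H pol h.+1; set hs := flatten hist.
have Rmin_le u v w : Rmin u (Rmin v w) <= w.
  by apply: Rle_trans (Rmin_r _ _) (Rmin_r _ _).
apply: Rle_trans (Rplus_le_compat_r _ _ _ (Rmin_le _ _ _)) _.
have [h1 h_le] := andP hH.
have m_lt : (H - h < H)%N by rewrite ltn_subrL h1.
pose W := Wopt (H - h).
have W_V y : W y <= V y.
  by rewrite /W -subSS; apply: VQ_optimistic => //; rewrite !ltnS h_le.
have U_W y : U y <= W y by rewrite /W -subSS; apply: Vpi_aux_le_Wopt.
have gV y : V y - U y <= gap h.+1 y by apply: Rmax_r.
have E_le : Ex (Phat hs x a) (fun y => V y - W y) - Ex (P x a) (fun y => V y - W y) <=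
    lam * Ex (P x a) (gap h.+1) + INR #|X| * INR H * l2 / lam / INR n.
  apply: count_concentration_Ex => // y; last by have := gV y; have := U_W y; lra.
  have := W_V y; have := VQ_le_H (size hist).+1 hist h.+1 y; rewrite -/V.
  by have [] := Wopt_bounds (H - h) y; rewrite -/W; lra.
have W_le : Ex (Phat hs x a) W - Ex (P x a) W <= 2 * INR H * sqrt (L / INR n).
  apply: Rle_trans (Rle_abs _) _.
  by have := value_conc (leqnn _); rewrite take_size; apply.
have P_le : Ex (P x a) (fun y => V y - U y) <= Ex (P x a) (gap h.+1) by apply: Ex_le.
set c := _ / INR n in E_le *.
move: E_le P_le (b_beta n0); rewrite !Ex_sub; lra.
Qed.

(** Each step loses two factors [1 + lam]: one in [gap_step], one in passing from the conditional
    mean of the gap to its realised value. The prefactor is the loss accumulated up to step [h]. *)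
Definition gap_weight (h : nat) (t : transition X Ac) : R :=
  ((1 + lam) ^ 2) ^ h.-1 * (1 + lam) *
  (Ex (P t.1.1 t.1.2) (gap h.+1) - (1 + lam) * gap h.+1 t.2).

Variable B : R.
Hypothesis B_ge : forall h, (h <= H)%N -> ((1 + lam) ^ 2) ^ h.-1 <= B.

(** Unrolling [gap_step] along the trace: with [r = (1 + lam)^2], the mean of the next gap splits
    into [gap_weight] and [r^h] times its realised value, which the next step takes up. *)
Lemma gap_episode n h x tr : (1 <= h)%N -> (h + n = H.+1)%N ->
  valid_ep pol n h x tr ->
  ((1 + lam) ^ 2) ^ h.-1 * gap h x <=
  ep_weight gap_weight h tr +
  B * \big[Rplus/0]_(t <- tr) step_cost (N2 (flatten hist) t.1.1 t.1.2).
Proof.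
elim: n h x tr => [|n IHn] h x [|t tr] //= h1.
  by rewrite addn0 => -> _; rewrite gap_end big_nil; lra.
rewrite addnS => -[hn] [t1 /IHn]; rewrite addSn hn => /(_ (ltn0Sn _) erefl) IH.
have hH : (h <= H)%N by rewrite -hn leq_addr.
rewrite big_cons t1 [gap_weight h t]/gap_weight t1 /=; set c := step_cost _.
set g := Ex _ (gap h.+1).
have step : gap h x <= c + (1 + lam) * g by apply: gap_step; rewrite h1.
have c0 : 0 <= c by apply: step_cost_ge0.
set r := ((1 + lam) * ((1 + lam) * 1)) in IH *.
have r_eq : r = (1 + lam) ^ 2 by [].
have r0 : 0 <= r by rewrite r_eq; apply: pow2_ge_0.
have rh0 : 0 <= r ^ h.-1 by apply: pow_le.
have rB : r ^ h.-1 <= B by rewrite r_eq; apply: B_ge.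
have rS : r ^ h.+1.-1 = r ^ h.-1 * r by case: (h) h1 => // h' _ /=; ring.
move: IH; rewrite rS => IH.
move: {rB} (Rmult_le_compat_l _ _ _ rh0 step) (Rmult_le_compat_r _ _ _ c0 rB) IH.
rewrite /r; move: (_ ^ h.-1) (gap h x) (gap h.+1 t.2) (\big[_/_]_(_ <- tr) _) => p d d' s h2 h3 IH.
lra.
Qed.

End MDP.

(** * Total cost by a potential argument *)

Lemma inv_antitone (x y : R) : 0 < x -> x <= y -> / y <= / x.
Proof. by move=> x0 xy; apply: Rinv_le_contravar. Qed.

(** All [d] visits are charged at the old count [x]. Charging at [x + d] instead telescopes into
    [2 sqrt]; the difference is at most [h (1 / sqrt x - 1 / sqrt (x + d))], which telescopes as
    well. *)
Lemma sqrt_potential (x h d : R) : 0 < x -> 0 <= d <= h ->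
  d / sqrt x <= (2 * sqrt (x + d) - h / sqrt (x + d)) - (2 * sqrt x - h / sqrt x).
Proof.
move=> x0 [d0 dh]; have u0 := sqrt_lt_R0 _ x0.
have uv : sqrt x <= sqrt (x + d) by apply: sqrt_le_1_alt; lra.
have -> : d = sqrt (x + d) ^ 2 - sqrt x ^ 2 by rewrite !pow2_sqrt; lra.
rewrite [in X in _ <= X](_ : x + _ = x + d); last by rewrite !pow2_sqrt; lra.
have dE : sqrt (x + d) ^ 2 - sqrt x ^ 2 <= h by rewrite !pow2_sqrt; lra.
move: (sqrt x) (sqrt (x + d)) u0 uv dE => u v u0 uv dE {x0 d0 dh d x}.
have inv_uv := inv_antitone u0 uv.
have v0 : 0 < v by lra.
have h1 : (v ^ 2 - u ^ 2) * (/ u - / v) <= h * (/ u - / v).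
  by apply: Rmult_le_compat_r => //; lra.
have h2 : (v ^ 2 - u ^ 2) / v <= 2 * (v - u).
  apply: (Rmult_le_reg_r v) => //.
  have -> : (v ^ 2 - u ^ 2) / v * v = v ^ 2 - u ^ 2 by field; lra.
  nra.
by rewrite /Rdiv in h2 *; lra.
Qed.

(** The same delay correction, with [ln t <= t - 1] at [t = x / (x + d)]. *)
Lemma log_potential (x h d : R) : 0 < x -> 0 <= d <= h ->
  d / x <= (ln (x + d) - h / (x + d)) - (ln x - h / x).
Proof.
move=> x0 [d0 dh]; have y0 : 0 < x + d by lra.
have inv_xy : / (x + d) <= / x by apply: inv_antitone; lra.
have h1 : d * (/ x - / (x + d)) <= h * (/ x - / (x + d)).
  by apply: Rmult_le_compat_r => //; lra.
have h2 : d / (x + d) <= ln (x + d) - ln x.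
  have xy0 : 0 < x / (x + d) by apply: Rdiv_lt_0_compat.
  have : ln (x / (x + d)) <= x / (x + d) - 1.
    rewrite -[X in _ <= X]ln_exp; apply: ln_mono => //.
    by have := exp_ge_1x (x / (x + d) - 1); lra.
  rewrite /Rdiv ln_mult ?ln_Rinv //; last exact: Rinv_0_lt_compat.
  rewrite -!/(Rdiv _ _); have -> : d / (x + d) = 1 - x / (x + d) by field; lra.
  lra.
by rewrite /Rdiv in h2 *; lra.
Qed.

Section Potential.
Variables (X Ac : finType) (H : nat) (lam l2 beta : R).
Hypotheses (H_gt0 : (1 <= H)%N) (lam_gt0 : 0 < lam) (l2_ge0 : 0 <= l2) (beta_ge0 : 0 <= beta).
Let kappa := INR #|X| * INR H * l2 / lam.
Local Notation cost := (step_cost X H lam l2 beta).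

(** The first term pays [H] per visit made at a count below [H]; one episode may carry such a count
    up to [2 H], hence the cap. The tail enters at [n >= H], and the final [+ 1] keeps it
    nonnegative there, so crossing the threshold never lowers the potential. *)
Definition potential (n : nat) : R :=
  INR H * INR (minn n (2 * H)) +
  if (n < H)%N then 0 else
    beta * (2 * sqrt (INR n) - INR H / sqrt (INR n)) +
    kappa * (ln (INR n) - INR H / INR n + 1).

Lemma kappa_ge0 : 0 <= kappa.
Proof.
apply: Rle_mult_inv_pos => //; apply: Rmult_le_pos => //.
by apply: Rmult_le_pos; apply: pos_INR.
Qed.

Lemma H_ge1 : 1 <= INR H. Proof. exact: INR_ge1. Qed.

Lemma potential_tail_ge0 n : (H <= n)%N ->
  0 <= beta * (2 * sqrt (INR n) - INR H / sqrt (INR n)) +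
       kappa * (ln (INR n) - INR H / INR n + 1).
Proof.
move=> /INR_leq Hn; have H1 := H_ge1; have k0 := kappa_ge0.
have n1 : 1 <= INR n by lra.
have s0 : 0 < sqrt (INR n) by apply: sqrt_lt_R0; lra.
apply: Rplus_le_le_0_compat; apply: Rmult_le_pos => //.
  have : INR H / sqrt (INR n) <= sqrt (INR n).
    apply: (Rmult_le_reg_r (sqrt (INR n))) => //.
    rewrite /Rdiv Rmult_assoc Rinv_l; last lra.
    by rewrite sqrt_sqrt; lra.
  lra.
have : 0 <= ln (INR n) by rewrite -ln_1; apply: ln_mono; lra.
have : INR H / INR n <= 1.
  apply: (Rmult_le_reg_r (INR n)); first lra.
  by rewrite /Rdiv Rmult_assoc Rinv_l; lra.
lra.
Qed.

Lemma potential_step (n d : nat) : (d <= H)%N ->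
  INR d * cost n <= potential (n + d) - potential n.
Proof.
move=> le_dH; have H1 := H_ge1; rewrite /step_cost /potential -/kappa.
case: (ltnP n H) => [lt_nH|le_Hn].
  have -> : minn n (2 * H) = n by apply/minn_idPl/ltnW/(leq_trans lt_nH); rewrite leq_pmull.
  have -> : minn (n + d) (2 * H) = (n + d)%N.
    by apply/minn_idPl; rewrite mul2n -addnn leq_add // ltnW.
  case: (ltnP (n + d) H) => [_|/potential_tail_ge0 tail0]; first by rewrite plus_INR; lra.
  by move: (_ + _) tail0 => c c0; rewrite plus_INR; lra.
have -> : (n + d < H)%N = false by rewrite ltnNge (leq_trans le_Hn) ?leq_addr.
have le_min : INR H * INR (minn n (2 * H)) <= INR H * INR (minn (n + d) (2 * H)).
  apply: Rmult_le_compat_l; first lra.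
  by apply: INR_leq; rewrite leq_min geq_minr andbT (leq_trans (geq_minl _ _)) // leq_addr.
have n0 : 0 < INR n by have := INR_leq le_Hn; lra.
have dH : 0 <= INR d <= INR H by split; [exact: pos_INR | exact: INR_leq].
rewrite plus_INR.
have := Rmult_le_compat_l _ _ _ beta_ge0 (sqrt_potential n0 dH).
have := Rmult_le_compat_l _ _ _ kappa_ge0 (log_potential n0 dH).
rewrite /Rdiv; lra.
Qed.

Lemma potential_le (n T : nat) : (n <= T)%N -> (1 <= T)%N ->
  potential n <= 2 * INR H ^ 2 + beta * (2 * sqrt (INR n)) + kappa * (ln (INR T) + 1).
Proof.
move=> nT T1; have H1 := H_ge1; have k0 := kappa_ge0; rewrite /potential.
have T1' := INR_ge1 T1.
have lnT : 0 <= ln (INR T) by rewrite -ln_1; apply: ln_mono; lra.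
have kT : 0 <= kappa * (ln (INR T) + 1) by apply: Rmult_le_pos; lra.
have s0 := sqrt_pos (INR n).
have bs : 0 <= beta * (2 * sqrt (INR n)) by apply: Rmult_le_pos; lra.
have : INR (minn n (2 * H)) <= 2 * INR H.
  by have := INR_leq (geq_minr n (2 * H)); rewrite mult_INR [INR 2]/=; lra.
case: (ltnP n H) => [_|le_Hn] le_min; first nra.
have n1 : 1 <= INR n by have := INR_leq le_Hn; lra.
have sn : 0 <= INR H / sqrt (INR n).
  by apply: Rle_mult_inv_pos; [lra | apply: sqrt_lt_R0; lra].
have hn : 0 <= INR H / INR n by apply: Rle_mult_inv_pos; lra.
have ln_n : ln (INR n) <= ln (INR T) by apply: ln_mono; [lra | exact: INR_leq].
have h1 : beta * (2 * sqrt (INR n) - INR H / sqrt (INR n)) <= beta * (2 * sqrt (INR n)).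
  by apply: Rmult_le_compat_l => //; lra.
have h2 : kappa * (ln (INR n) - INR H / INR n + 1) <= kappa * (ln (INR T) + 1).
  by apply: Rmult_le_compat_l => //; lra.
nra.
Qed.

Implicit Types (tr hs : seq (transition X Ac)) (hist : seq (seq (transition X Ac))).

(** Counts are frozen during an episode, so its costs group by pair into at most [H] visits at one
    count, the situation of [potential_step]. *)
Lemma run_cost_le hist : (forall tr, tr \in hist -> size tr = H) ->
  \big[Rplus/0]_(k < size hist) \big[Rplus/0]_(t <- nth [::] hist k)
     cost (N2 (flatten (take k hist)) t.1.1 t.1.2) <=
  \big[Rplus/0]_(s : X * Ac) potential (N2 (flatten hist) s.1 s.2).
Proof.
elim/last_ind: hist => [|hist tr IH] sizes.
  rewrite big_ord0; apply: sumR_ge0 => s _.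
  by rewrite /potential /= H_gt0 min0n /=; lra.
rewrite size_rcons big_ord_recr /=.
under eq_bigr => k _ do rewrite nth_rcons ltn_ord take_rcons_le 1?ltnW //.
apply: Rle_trans (Rplus_le_compat_r _ _ _ (IH _)) _.
  by move=> tr' tr'_in; apply: sizes; rewrite mem_rcons in_cons tr'_in orbT.
rewrite nth_rcons ltnn eqxx take_rcons_le // take_size flatten_rcons.
rewrite (sum_transitions tr (fun s => cost (N2 (flatten hist) s.1 s.2))).
rewrite -big_split; apply: sumR_le => s _ /=; rewrite N2_cat.
have le_H : (N2 tr s.1 s.2 <= H)%N.
  rewrite -(sizes tr); first exact: N2_le_size.
  by rewrite mem_rcons in_cons eqxx.
by have := potential_step (N2 (flatten hist) s.1 s.2) le_H; lra.
Qed.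
End Potential.

(** * Regret on the concentration event *)

(** Concavity: each square root lies below the tangent at the average [N / #|I|], whose square root
    is [s]. *)
Lemma sum_sqrt_le (I : finType) (n : I -> nat) (N : nat) :
  (0 < #|I|)%N -> (0 < N)%N -> \Sum_i INR (n i) = INR N ->
  \Sum_i sqrt (INR (n i)) <= sqrt (INR #|I| * INR N).
Proof.
move=> /INR_gt0 C0 /INR_gt0 N0 sum_n; set C := INR #|I| in C0 *.
pose s := sqrt (INR N / C).
have s0 : 0 < s by apply: sqrt_lt_R0; apply: Rdiv_lt_0_compat.
have s2 : s * s = INR N / C by apply/sqrt_sqrt/Rlt_le/Rdiv_lt_0_compat.
have term i : sqrt (INR (n i)) <= / (2 * s) * INR (n i) + s / 2.
  have r2 := sqrt_sqrt _ (pos_INR (n i)); set r := sqrt _ in r2 *.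
  apply: (Rmult_le_reg_l (2 * s)); first lra.
  rewrite -r2 Rmult_plus_distr_l -Rmult_assoc Rinv_r; last lra.
  have := pow2_ge_0 (r - s); lra.
apply: Rle_trans (sumR_le _ (fun i _ => term i)) _.
rewrite big_split /= -big_distrr /= sum_n sumR_const -/C.
have -> : INR N = C * (s * s) by rewrite s2; field; lra.
rewrite (_ : C * (C * (s * s)) = (C * s) ^ 2); last by ring.
rewrite sqrt_pow2; last by apply: Rmult_le_pos; lra.
by right; field; lra.
Qed.

Lemma ep_weight_scale (X Ac : finType) (c : R) (z : nat -> transition X Ac -> R) h tr :
  ep_weight (fun h' t => c * z h' t) h tr = c * ep_weight z h tr.
Proof. by elim: tr h => [|t tr IH] h /=; rewrite ?IH; lra. Qed.

Section Regret.
Variables (X Ac : finType) (a0 : Ac) (P : X -> Ac -> X -> R) (rew : X -> Ac -> R) (H : nat).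
Hypotheses (P_ge0 : forall x a y, 0 <= P x a y)
           (P_sum : forall x a, \Sum_y P x a y = 1)
           (rew01 : forall x a, 0 <= rew x a <= 1) (H_gt0 : (1 <= H)%N).
Variables (b : nat -> R) (L lam l2 beta B : R).
Hypotheses (lam_gt0 : 0 < lam) (l2_ge0 : 0 <= l2) (beta_ge0 : 0 <= beta).
Hypothesis b_optimistic : forall n, (0 < n)%N -> 2 * INR H * sqrt (L / INR n) <= b n.
Hypothesis b_beta : forall n, (0 < n)%N ->
  b n + 2 * INR H * sqrt (L / INR n) <= beta / sqrt (INR n).
Hypothesis B_ge : forall h, (h <= H)%N -> ((1 + lam) ^ 2) ^ h.-1 <= B.

Variables (agent : seq (seq (transition X Ac)) -> X -> nat -> Ac)
          (init : seq (seq (transition X Ac)) -> X).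
Hypothesis agent_greedy : forall hist h x a, (1 <= h <= H)%N ->
  Qnext a0 rew H b hist h x a <= Qnext a0 rew H b hist h x (agent hist x h).

(** Optimism bounds the regret of an episode by its initial gap, [gap_episode] by martingale weights
    and costs, and the potential sums the costs over the run. *)
Lemma regret_le (hist : seq (seq (transition X Ac))) (g3 : R) :
  valid_run H agent init hist -> (0 < size hist)%N ->
  (forall j, (j <= size hist)%N ->
     value_concentration a0 P rew H L (flatten (take j hist))) ->
  (forall j, (j <= size hist)%N ->
     count_concentration P lam l2 (flatten (take j hist))) ->
  run_weight (fun pre => gap_weight a0 P rew H b lam pre (agent pre)) hist <= g3 ->
  let T := (size hist * H)%N in
  regret P rew H a0 agent init hist <=
  g3 + B * (INR #|X| * INR #|Ac| *
              (2 * INR H ^ 2 + INR #|X| * INR H * l2 / lam * (ln (INR T) + 1)) +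
            2 * beta * sqrt (INR #|X| * INR #|Ac| * INR T)).
Proof.
move=> vh K0 vconc cconc gapK T.
have B0 : 0 <= B by apply: Rle_trans (B_ge (leq0n H)); rewrite /=; lra.
pose cost (k : nat) := \big[Rplus/0]_(t <- nth [::] hist k)
  step_cost X H lam l2 beta (N2 (flatten (take k hist)) t.1.1 t.1.2).
have ep_le (k : 'I_(size hist)) : Vstar P rew H a0 1 (init (take k hist)) -
    Vpi P rew H (agent (take k hist)) 1 (init (take k hist)) <=
    ep_weight (gap_weight a0 P rew H b lam (take k hist) (agent (take k hist))) 1
      (nth [::] hist k) + B * cost k.
  have ltk := ltn_ord k; have sz : size (take k hist) = k by rewrite size_takel // ltnW.
  have vc i : (i <= size (take k hist))%N ->
      value_concentration a0 P rew H L (flatten (take i (take k hist))).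
    rewrite sz => ik; rewrite take_takel //; apply: vconc.
    exact: leq_trans ik (ltnW ltk).
  apply: Rle_trans (_ : gap a0 P rew H b (take k hist) (agent (take k hist)) 1
                          (init (take k hist)) <= _).
    apply: Rle_trans (Rmax_r _ _); apply: Rplus_le_compat_r.
    apply: Rle_trans (Vstar_le_Wopt a0 rew H P_ge0 1 _) _.
    exact: (VQ_optimistic P_ge0 P_sum rew01 H_gt0 b_optimistic).
  have := @gap_episode X Ac a0 P rew H P_ge0 P_sum rew01 H_gt0 b L lam l2 beta
    lam_gt0 l2_ge0 beta_ge0 b_optimistic (take k hist) (agent (take k hist))
    (agent_greedy (take k hist)) vc (cconc _ (ltnW ltk)) b_beta B B_ge H 1
    (init (take k hist)) (nth [::] hist k) (leqnn _) (add1n H) (vh k ltk).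
  by rewrite pow_O Rmult_1_l.
apply: Rle_trans (sumR_le _ (fun k _ => ep_le k)) _.
rewrite big_split /=; apply: Rplus_le_compat => //.
rewrite -big_distrr /=; apply: Rmult_le_compat_l => //.
have sizes tr : tr \in hist -> size tr = H by apply: valid_run_sizes vh.
apply: Rle_trans (run_cost_le H_gt0 lam_gt0 l2_ge0 beta_ge0 sizes) _.
have sizeT : size (flatten hist) = T by apply: valid_run_size_flatten vh.
have T0 : (0 < T)%N by rewrite muln_gt0 K0.
have s_le (s : X * Ac) := potential_le X H_gt0 lam_gt0 l2_ge0 beta_ge0
  (leq_trans (N2_le_size (flatten hist) s.1 s.2) (eq_leq sizeT)) T0.
apply: Rle_trans (sumR_le _ (fun s _ => s_le s)) _.
have cardXA : INR #|{: X * Ac}| = INR #|X| * INR #|Ac| by rewrite card_prod mult_INR.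
have := @sum_sqrt_le (X * Ac)%type (fun s => N2 (flatten hist) s.1 s.2) T.
rewrite sum_N2 sizeT cardXA => /(_ _ T0 erefl) root_le.
rewrite !big_split /= !sumR_const cardXA -!big_distrr /=.
have := root_le _; rewrite card_prod muln_gt0.
have -> : (0 < #|X|)%N by apply/card_gt0P; exists (init [::]).
have -> : (0 < #|Ac|)%N by apply/card_gt0P; exists a0.
move=> /(_ isT) /(Rmult_le_compat_l (2 * beta)) => /(_ ltac:(lra)).
move: (_ / lam) (\big[_/_]_i _) (sqrt _) => c s r; lra.
Qed.

End Regret.

(** * The three families of exponential supermartingales *)

(** If [sqrt (L / n) >= 1] the range bound on [d] suffices. Otherwise [c = sqrt (L / n)] balances
    the two costs, as then [n c^2 = L]. *)
Lemma deviation_le (n h L d : R) : 0 < n -> 0 < h -> 0 < L -> Rabs d <= h ->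
  let c := Rmin 1 (sqrt (L / n)) in
  (forall s : bool, (if s then 1 else -1) * (c / h) * (n * d) - n * c ^ 2 <= L) ->
  Rabs d <= 2 * h * sqrt (L / n).
Proof.
move=> n0 h0 L0 dh c dev.
have r0 : 0 < sqrt (L / n) by apply/sqrt_lt_R0/Rdiv_lt_0_compat.
have rr : L = n * (sqrt (L / n) * sqrt (L / n)).
  by rewrite sqrt_sqrt; [field; lra | apply/Rlt_le/Rdiv_lt_0_compat].
move: (sqrt (L / n)) r0 rr @c dev => r r0 -> c dev.
have [r1|r1] := Rle_lt_dec 1 r; first nra.
have c_r : c = r by apply: Rmin_right; lra.
rewrite c_r in dev.
have side (s : bool) : (if s then 1 else -1) * d <= 2 * h * r.
  have := dev s; move: (if s then 1 else -1) => g dev_s.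
  apply: (Rmult_le_reg_r (n * r / h)).
    by apply: Rdiv_lt_0_compat => //; apply: Rmult_lt_0_compat.
  have -> : g * d * (n * r / h) = g * (r / h) * (n * d) by field; lra.
  have -> : 2 * h * r * (n * r / h) = 2 * (n * (r * r)) by field; lra.
  lra.
by have := side true; have := side false; move=> /= s1 s2; apply: Rabs_le; lra.
Qed.

Lemma pow_le_exp (x : R) (n : nat) : 0 <= 1 + x -> (1 + x) ^ n <= exp (INR n * x).
Proof.
move=> x0; elim: n => [|n IHn]; first by rewrite /= Rmult_0_l exp_0; lra.
rewrite (_ : INR n.+1 * x = x + INR n * x); last by rewrite S_INR; ring.
rewrite exp_plus -tech_pow_Rmult.
by apply: Rmult_le_compat => //; [apply: pow_le | apply: exp_ge_1x].
Qed.

Section Families.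
Variables (X Ac : finType) (a0 : Ac) (P : X -> Ac -> X -> R) (rew : X -> Ac -> R) (H : nat).
Hypotheses (P_ge0 : forall x a y, 0 <= P x a y)
           (P_sum : forall x a, \Sum_y P x a y = 1)
           (rew01 : forall x a, 0 <= rew x a <= 1) (H_gt0 : (1 <= H)%N).
Implicit Types (hs : seq (transition X Ac)) (hist : seq (seq (transition X Ac))).
Local Notation W := (Wopt a0 P rew).

Lemma W_le_H m y : (m < H)%N -> 0 <= W m y <= INR H.
Proof.
move=> mH; have := Wopt_bounds a0 P_ge0 P_sum rew01 m y.
have := INR_leq (ltnW mH); lra.
Qed.

Lemma Ex_W_le_H (q : X -> R) m : (m < H)%N ->
  (forall y, 0 <= q y) -> \Sum_y q y = 1 -> 0 <= Ex q (W m) <= INR H.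
Proof.
move=> mH q0 q1; split; first by apply: Ex_ge0 => // y; case: (W_le_H y mH).
by rewrite -(Ex_const q1 (INR H)); apply: Ex_le => // y; case: (W_le_H y mH).
Qed.

Lemma visit_exp_le1 (f : X -> R) x a x' a' :
  Ex (P x a) (fun y => exp (f y)) <= 1 ->
  Ex (P x' a') (fun y => exp (if visit x a (x', a', y) then f y else 0)) <= 1.
Proof.
move=> f1; rewrite /visit /=; case: andP => [[/eqP -> /eqP ->] //|_].
by rewrite Ex_const // exp_0; lra.
Qed.

(* The tilt [c / H] is tuned to the visit count [n] at which the bound will be used. *)
Definition value_weight (L : R) (n m : nat) (s : bool) x a (t : transition X Ac) : R :=
  let c := Rmin 1 (sqrt (L / INR n)) in
  if visit x a t
  then (if s then 1 else -1) * (c / INR H) * (W m t.2 - Ex (P x a) (W m)) - c ^ 2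
  else 0.

Lemma value_weight_le1 L n m s x a x' a' : (m < H)%N ->
  Ex (P x' a') (fun y => exp (value_weight L n m s x a (x', a', y))) <= 1.
Proof.
move=> mH; apply: visit_exp_le1; cbn [snd]; have H1 := INR_ge1 H_gt0.
have c0 : 0 <= Rmin 1 (sqrt (L / INR n)) by apply: Rmin_glb; [lra | exact: sqrt_pos].
have c1 := Rmin_l 1 (sqrt (L / INR n)).
set c := Rmin _ _ in c0 c1 *; set g : R := if s then 1 else -1.
have g1 : g = 1 \/ g = -1 by rewrite /g; case: (s); [left | right].
have dev y : Rabs (W m y - Ex (P x a) (W m)) <= INR H.
  have := W_le_H y mH; have := Ex_W_le_H mH (P_ge0 x a) (P_sum x a).
  by move=> ? ?; apply: Rabs_le; lra.
have abs_c y : Rabs (g * (c / INR H) * (W m y - Ex (P x a) (W m))) <= c.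
  have ch0 : 0 <= c / INR H by apply: Rle_mult_inv_pos; lra.
  rewrite 2!Rabs_mult (_ : Rabs g = 1); last by case: g1 => ->; rewrite ?Rabs_Ropp Rabs_R1.
  rewrite Rmult_1_l (Rabs_pos_eq _ ch0).
  rewrite -[X in _ <= X](_ : c / INR H * INR H = c); last by field; lra.
  exact: Rmult_le_compat_l (dev y).
apply: (chernoff_centered (v := c ^ 2)) => // [|y|y].
- by rewrite Ex_scale Ex_sub Ex_const //; ring.
- exact: Rle_trans (abs_c y) c1.
- by rewrite -pow2_abs; apply: pow_incr; split => //; apply: Rabs_pos.
Qed.

(** The count is random, but the deviation bound is available for every tilt index [n] up to [T], so
    it may be used at [n = N2 hs x a]. *)
Lemma value_weight_concentration L T hs : 0 < L ->
  (forall x a, (N2 hs x a <= T)%N) ->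
  (forall n m s x a, (0 < n <= T)%N -> (m < H)%N ->
     \big[Rplus/0]_(t <- hs) value_weight L n m s x a t <= L) ->
  value_concentration a0 P rew H L hs.
Proof.
move=> L0 NT dev x a m mH N0; have n0 := INR_gt0 N0; have H1 := INR_ge1 H_gt0.
apply: deviation_le => //; first lra.
  have := Ex_W_le_H mH (P_ge0 x a) (P_sum x a).
  have := Ex_W_le_H mH (fun y => Phat_ge0 y N0) (Phat_sum N0).
  by move=> ? ?; apply: Rabs_le; lra.
move=> s; have := dev (N2 hs x a) m s x a; rewrite N0 NT => /(_ isT mH).
rewrite /value_weight (sum_visits_next hs x a (fun y => _ * (W m y - _) - _)).
set c := Rmin _ _; set g := (if s then 1 else -1) * (c / INR H).
set w := Ex (P x a) (W m); apply: Rle_trans; right.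
have -> : \Sum_y (INR (N3 hs x a y) * (g * (W m y - w) - c ^ 2)) =
   INR (N2 hs x a) * Ex (Phat hs x a) (fun y => g * (W m y - w) - c ^ 2).
  rewrite -[RHS]Ex_scale; apply: eq_bigr => y _; rewrite /Phat; field; lra.
rewrite Ex_sub Ex_scale Ex_sub !(Ex_const (Phat_sum N0)); ring.
Qed.

Definition count_weight (lam : R) x a y (t : transition X Ac) : R :=
  if visit x a t then lam * INR (t.2 == y) - lam * (1 + lam) * P x a y else 0.

Lemma count_weight_le1 lam x a y x' a' : 0 <= lam <= 1 ->
  Ex (P x' a') (fun y' => exp (count_weight lam x a y (x', a', y'))) <= 1.
Proof. by move=> lam01; apply: visit_exp_le1; apply: chernoff_indicator. Qed.

Lemma count_weight_concentration lam l2 hs : 0 < lam ->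
  (forall x a y, \big[Rplus/0]_(t <- hs) count_weight lam x a y t <= l2) ->
  count_concentration P lam l2 hs.
Proof.
move=> lam0 dev x a y; have := dev x a y; rewrite /count_weight.
rewrite (sum_visits_next hs x a (fun y' => _ * INR (y' == y) - _)).
under eq_bigr => y' _ do rewrite Rmult_minus_distr_l.
rewrite sumR_sub -(big_distrl (lam * (1 + lam) * P x a y)) /= sum_N3.
rewrite (bigD1 y) //= big1 => [|y' /negbTE ->]; last by rewrite /=; ring.
rewrite eqxx /= => le; apply: (Rmult_le_reg_l lam) => //.
rewrite Rmult_plus_distr_l (_ : lam * (l2 / lam) = l2); last by field; lra.
lra.
Qed.

(** An instance of [chernoff_nonneg], whose smallness condition follows from the gap being at most
    [H]. *)
Lemma gap_weight_le1 b lam s hist pol h x : (1 <= h <= H)%N ->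
  0 <= lam -> 0 <= s ->
  s * (((1 + lam) ^ 2) ^ h.-1 * (1 + lam) ^ 3 * INR H) <= lam ->
  Ex (P x (pol x h)) (fun y =>
    exp (s * gap_weight a0 P rew H b lam hist pol h (x, pol x h, y))) <= 1.
Proof.
move=> hH lam0 s0 small; rewrite /gap_weight /=.
set r := _ ^ h.-1; set D := gap a0 P rew H b hist pol h.+1.
have r0 : 0 <= r by apply/pow_le/Rmult_le_pos; lra.
have sr0 : 0 <= s * (r * (1 + lam)) by apply: Rmult_le_pos => //; apply: Rmult_le_pos; lra.
rewrite (@Ex_ext _ _ _ (fun y => exp (s * (r * (1 + lam)) *
   (Ex (P x (pol x h)) D - (1 + lam) * D y)))); last by move=> y; congr exp; ring.
apply: chernoff_nonneg => // y; first exact: gap_ge0.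
apply: Rle_trans small.
rewrite [X in _ <= X](_ : _ = s * (r * (1 + lam)) * (1 + lam) ^ 2 * INR H); last first.
  by rewrite /r /=; ring.
apply: Rmult_le_compat_l; last exact: gap_le_H.
by apply: Rmult_le_pos => //; apply: pow2_ge_0.
Qed.

End Families.

(** * Constants *)

Lemma ln_le_twice (x y : R) : 0 < x -> 0 < y -> x <= y ^ 2 -> ln x <= 2 * ln y.
Proof.
move=> x0 y0 xy; have -> : 2 * ln y = ln (y ^ 2) by rewrite /= Rmult_1_r ln_mult //; lra.
exact: ln_mono.
Qed.

Lemma ln_ge1 (x : R) : 3 <= x -> 1 <= ln x.
Proof.
move=> x3; rewrite -[X in X <= _]ln_exp; apply: ln_mono; first exact: exp_pos.
by have := exp_le_3; lra.
Qed.

Lemma log_constants (h S A T delta : R) :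
  1 <= h -> 1 <= S -> 1 <= A -> h <= T -> 0 < delta < 1 ->
  let L := ln (5 * h * S * A * T / delta) in
  let L' := ln (5 * S * A * T / delta) in
  let l2 := ln (/ (delta / (5 * S * A * S))) in
  [/\ 1 <= L', L' <= L, L <= 2 * L', 0 <= l2 <= 2 * L &
      ln T + 1 <= L /\ ln (/ (delta / 5)) <= L].
Proof.
move=> h1 S1 A1 hT [d0 d1] L L' l2.
have T1 : 1 <= T by lra.
have i1 : 1 <= / delta by rewrite -Rinv_1; apply: Rinv_le_contravar; lra.
have SA1 : 1 <= S * A by nra.
have SAT1 : T <= S * A * T by nra.
have y_ge : 5 * T <= 5 * S * A * T / delta.
  have p : 0 <= 5 * (S * A * T) by lra.
  have := Rmult_le_compat_l _ _ _ p i1; rewrite /Rdiv; lra.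
set y := _ / delta in y_ge L' *.
have LE : L = ln (h * y) by rewrite /L /y; f_equal; field; lra.
have yhy : y <= h * y by nra.
have d5 : / (delta / 5) = 5 / delta by field; lra.
have l2E : l2 = ln (5 * S * A * S / delta).
  by rewrite /l2; f_equal; field; lra.
have y_S : 5 * S * A / delta <= y.
  have p : 0 <= 5 * S * A / delta by apply: Rle_mult_inv_pos; nra.
  have := Rmult_le_compat_l _ _ _ p T1; rewrite /y /Rdiv; lra.
have dS : 5 * S / delta <= 5 * S * A / delta.
  by apply: Rmult_le_compat_r; [lra | nra].
have S_y : 5 * S <= 5 * S / delta.
  have p : 0 <= 5 * S by lra.
  have := Rmult_le_compat_l _ _ _ p i1; rewrite /Rdiv; lra.
have d5S : 5 / delta <= 5 * S / delta by apply: Rmult_le_compat_r; lra.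
have SAS : 5 * S * A * S / delta = S * (5 * S * A / delta) by field; lra.
split.
- by apply: ln_ge1; lra.
- by rewrite LE; apply: ln_mono; lra.
(* Here [h <= T <= y] gives [h y <= y^2]. *)
- by rewrite LE; apply: ln_le_twice; nra.
(* Both factors [S] and [5 S A / delta] are at most [y <= h y]. *)
- rewrite l2E SAS; split; last by rewrite LE; apply: ln_le_twice; nra.
  by rewrite -ln_1; apply: ln_mono; nra.
split; last by rewrite d5 LE; apply: ln_mono; lra.
have -> : ln T + 1 = ln (T * exp 1) by rewrite ln_mult ?ln_exp //; [lra | exact: exp_pos].
rewrite LE; apply: ln_mono; first by apply: Rmult_lt_0_compat; [lra | exact: exp_pos].
have := exp_le_3; nra.
Qed.

(** At most [2 H] factors contribute [1 / (50 H)] each to the exponent, and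
    [exp (1 / 25) <= 1 / (1 - 1 / 25)]. *)
Lemma compound_growth (H h : nat) : (1 <= H)%N -> (h <= H)%N ->
  ((1 + / (50 * INR H)) ^ 2) ^ h.-1 <= 25 / 24.
Proof.
move=> H1 hH; have H1' := INR_ge1 H1.
have lam0 : 0 < / (50 * INR H) by apply: Rinv_0_lt_compat; lra.
rewrite -pow_mult; apply: Rle_trans (pow_le_exp _ _) _; first lra.
have -> : 25 / 24 = / (1 - / 25) by field.
apply: Rle_trans (exp_le_inv _); last lra.
have le : INR (2 * h.-1) * / (50 * INR H) <= / 25.
  have -> : / 25 = 2 * INR H * / (50 * INR H) by field; lra.
  apply: Rmult_le_compat_r; first lra.
  rewrite mult_INR [INR 2]/=; have := INR_leq (leq_trans (leq_pred h) hH); lra.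
have [lt|->] := le; last by right.
by left; apply: exp_increasing.
Qed.

(** From [L <= 2 L' <= (2 L')^2] one gets [sqrt L <= 2 L'], and [4 <= 7]. *)
Lemma bonus_le (h L L' n : R) : 0 < h -> 1 <= L' -> 0 <= L <= 2 * L' -> 1 <= n ->
  2 * h * sqrt (L / n) <= 7 * h * L' * sqrt (1 / n).
Proof.
move=> h0 L1 LL n1; have -> : L / n = L * (1 / n) by field; lra.
rewrite sqrt_mult; [|lra|by apply: Rle_mult_inv_pos; lra].
have := sqrt_pos (1 / n); have sL : sqrt L <= 2 * L'.
  rewrite -[X in _ <= X]sqrt_pow2; last lra.
  by apply: sqrt_le_1_alt; nra.
move: (sqrt L) (sqrt (1 / n)) sL => u v uL v0.
have : h * v * u <= h * v * (2 * L').
  by apply: Rmult_le_compat_l => //; apply: Rmult_le_pos; lra.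
have : 0 <= h * v * L' by apply: Rmult_le_pos; [apply: Rmult_le_pos|]; lra.
lra.
Qed.

(** Leading constant: [25/24 * 2 * 9 = 18.75 <= 20]. Lower-order constant: [60 + 25/24 * (2 + 50 *
    2) = 166.25 <= 250]. *)
Lemma final_bound (h S A k L L' l2 l3 lT : R) :
  1 <= h -> 1 <= S -> 1 <= A -> 1 <= k -> 1 <= L' <= L ->
  0 <= l2 <= 2 * L -> 0 <= lT <= L -> l3 <= L ->
  60 * h ^ 2 * l3 + 25 / 24 *
    (S * A * (2 * h ^ 2 + S * h * l2 / (/ (50 * h)) * lT) +
     2 * (7 * h * L' + 2 * h * sqrt L) * sqrt (S * A * (k * h))) <=
  20 * (h * sqrt h) * L * sqrt (S * A * k) + 250 * h ^ 2 * S ^ 2 * A * L ^ 2.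
Proof.
move=> h1 S1 A1 k1 [L1 LL] [l20 l2L] [lT0 lTL] l3L.
have -> : S * A * (k * h) = h * (S * A * k) by ring.
have SA1 : 1 <= S * A by nra.
rewrite sqrt_mult; [|lra|nra].
have sL : sqrt L <= L.
  by rewrite -[X in _ <= X]sqrt_pow2; [apply: sqrt_le_1_alt; nra | lra].
have w0 : 0 <= h * (sqrt h * sqrt (S * A * k)).
  by apply: Rmult_le_pos; [lra | apply: Rmult_le_pos; apply: sqrt_pos].
have main : (7 * h * L' + 2 * h * sqrt L) * (sqrt h * sqrt (S * A * k)) <=
    9 * L * (h * (sqrt h * sqrt (S * A * k))).
  have -> : (7 * h * L' + 2 * h * sqrt L) * (sqrt h * sqrt (S * A * k)) =
    (7 * L' + 2 * sqrt L) * (h * (sqrt h * sqrt (S * A * k))) by ring.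
  by apply: Rmult_le_compat_r => //; lra.
have -> : S * h * l2 / (/ (50 * h)) * lT = 50 * S * h ^ 2 * (l2 * lT) by field; lra.
have h2 : 0 < h ^ 2 by apply: pow_lt; lra.
have l2lT : l2 * lT <= 2 * L ^ 2 by nra.
have LL1 : L <= L ^ 2 by nra.
have SA : A <= S * A by nra.
have SSA : S * A <= S ^ 2 * A by nra.
have c0 : 0 <= S * h ^ 2 by apply: Rmult_le_pos; lra.
have q1 := Rmult_le_compat_l _ _ _ (Rmult_le_pos _ _ c0 (Rlt_le _ _ (Rlt_le_trans _ _ _ Rlt_0_1 SA1))) l2lT.
have hL : h ^ 2 * L <= h ^ 2 * (S ^ 2 * A * L ^ 2).
  apply: Rmult_le_compat_l; first lra.
  apply: Rle_trans LL1 _; rewrite -[X in X <= _]Rmult_1_l.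
  by apply: Rmult_le_compat_r; nra.
have hl3 : h ^ 2 * l3 <= h ^ 2 * L by apply: Rmult_le_compat_l; lra.
have hSA : h ^ 2 * (S * A) <= h ^ 2 * (S ^ 2 * A * L ^ 2).
  apply: Rmult_le_compat_l; first lra.
  by apply: Rle_trans SSA _; rewrite -[X in X <= _]Rmult_1_r; apply: Rmult_le_compat_l; nra.
have hL0 : 0 <= h ^ 2 * L by apply: Rmult_le_pos; lra.
have wL : 0 <= L * (h * (sqrt h * sqrt (S * A * k))) by apply: Rmult_le_pos; lra.
move: (sqrt h) (sqrt (S * A * k)) (sqrt L) main wL q1 hL hl3 hSA => a c d main wL q1 hL hl3 hSA.
lra.
Qed.

(** * Choice of parameters and failure probabilities, and the regret bound *)

Theorem theorem1
  (X Ac : finType) (a0 : Ac)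
  (P : X -> Ac -> X -> R) (rew : X -> Ac -> R) (H K : nat) (delta : R)
  (HP_nonneg : forall x a y, 0 <= P x a y)
  (HP_sum : forall x a, \big[Rplus/0]_(y : X) P x a y = 1)
  (Hrew : forall x a, 0 <= rew x a <= 1)
  (HH : (1 <= H)%N) (HK : (1 <= K)%N) (Hdelta : 0 < delta)
  (tb : seq (seq (transition X Ac)) -> nat -> X -> Ac)
  (Htb : forall hist h x a, (1 <= h <= H)%N ->
     Qnext a0 rew H (bonus_CH #|X| #|Ac| H K delta) hist h x a <= Qnext a0 rew H (bonus_CH #|X| #|Ac| H K delta) hist h x (tb hist h x))
  (init : seq (seq (transition X Ac)) -> X) :
  let agent := fun hist x h => tb hist h x in
  let L := ln (5 * INR H * INR #|X| * INR #|Ac| * INR (K * H)%N / delta) in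
  let bound := 20 * (INR H * sqrt (INR H)) * L * sqrt (INR #|X| * INR #|Ac| * INR K)
                + 250 * INR H ^ 2 * INR #|X| ^ 2 * INR #|Ac| * L ^ 2 in
  (1 - delta <=
   prob_run P H agent init K
     (fun hist => Rle_dec (regret P rew H a0 agent init hist) bound)).
Proof.
move=> agent L bound.
pose f hist := if Rle_dec (regret P rew H a0 agent init hist) bound then 1 else 0.
have f0 hist : 0 <= f hist by rewrite /f; case: Rle_dec => /= *; lra.
change (1 - delta <= run_exp P H agent init K [::] f).
(* For [delta >= 1] the claim only says that a probability is nonnegative. *)
have [d1|d1] := Rle_lt_dec 1 delta.
  have := run_exp_ge0 HP_nonneg HP_sum H agent init K [::] f0; lra.
have X0 : (0 < #|X|)%N by apply/card_gt0P; exists (init [::]).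
have A0 : (0 < #|Ac|)%N by apply/card_gt0P; exists a0.
have h1 := INR_ge1 HH; have S1 := INR_ge1 X0; have A1 := INR_ge1 A0; have k1 := INR_ge1 HK.
have T0 : (0 < K * H)%N by rewrite muln_gt0 HK.
have T1 := INR_ge1 T0.
have TE : INR (K * H) = INR K * INR H by apply: mult_INR.
have hT : INR H <= INR (K * H) by rewrite TE; nra.
have [L'1 L'L LL' l2b [lnT l3L]] := log_constants h1 S1 A1 hT (conj Hdelta d1).
rewrite -/L in L'L LL' l2b lnT l3L.
set L' := ln _ in L'1 L'L LL'; set l2 := ln (/ _) in l2b; set l3 := ln (/ _) in l3L.
set b := bonus_CH _ _ _ _ _ in Htb.
pose lam := / (50 * INR H); pose mu := / (60 * INR H ^ 2).
have lam0 : 0 < lam by apply: Rinv_0_lt_compat; lra.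
have h2 : 0 < INR H ^ 2 by apply: pow_lt; lra.
have mu0 : 0 < mu by apply: Rinv_0_lt_compat; lra.
have lam_le : lam <= / 50 by apply: Rinv_le_contravar; lra.
(* Chosen so that [ln (/ pv) = L]. The three families receive [2/5], [1/5] and [1/5] of [delta]; the
   first counts double for its two signs. *)
pose pv := delta / (5 * INR H * INR #|X| * INR #|Ac| * INR (K * H)).
pose pc := delta / (5 * INR #|X| * INR #|Ac| * INR #|X|).
pose I : finType := ((X * Ac * 'I_H * 'I_(K * H) * bool) + (X * Ac * X) + unit)%type.
pose p (i : I) : R :=
  match i with inl (inl _) => pv | inl (inr _) => pc | inr _ => delta / 5 end.
pose z (i : I) (hist : seq (seq (transition X Ac))) (h : nat) (t : transition X Ac) : R :=
  match i with
  | inl (inl (x, a, m, n, s)) => value_weight a0 P rew H L n.+1 m s x a t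
  | inl (inr (x, a, y)) => count_weight P lam x a y t
  | inr _ => mu * gap_weight a0 P rew H b lam hist (agent hist) h t
  end.
have HSA0 : 0 < INR H * INR #|X| * INR #|Ac| * INR (K * H).
  by do !apply: Rmult_lt_0_compat; lra.
have SAS0 : 0 < INR #|X| * INR #|Ac| * INR #|X| by do !apply: Rmult_lt_0_compat; lra.
have pv0 : 0 < pv by apply: Rdiv_lt_0_compat; lra.
have pc0 : 0 < pc by apply: Rdiv_lt_0_compat; lra.
have LE : ln (/ pv) = L by rewrite /pv /L; f_equal; field; lra.
apply: (exponential_deviation HP_nonneg HP_sum (p := p) (z := z)) => //.
- by case=> [[i|i]|i] //=; lra.
- rewrite !big_sumType /= !sumR_const !card_prod !card_ord card_bool card_unit !mult_INR.
  rewrite -TE.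
  have -> : INR #|X| * INR #|Ac| * INR H * INR (K * H) * INR 2 * pv = 2 / 5 * delta.
    by rewrite /pv [INR 2]/=; field; lra.
  have -> : INR #|X| * INR #|Ac| * INR #|X| * pc = / 5 * delta by rewrite /pc; field; lra.
  by rewrite [INR 1]/=; lra.
- case=> [[[[[[x a] m] n] s]|[[x a] y]]|u] hist h x' hH /=.
  + by apply: value_weight_le1.
  + by apply: count_weight_le1 => //; lra.
  apply: gap_weight_le1 => //; [lra|lra|].
  have rho := compound_growth HH (proj2 (andP hH)).
  have cube : (1 + lam) ^ 3 <= 107 / 100.
    apply: Rle_trans (_ : (1 + / 50) ^ 3 <= _); last lra.
    by apply: pow_incr; lra.
  (* The constant [60] in [mu] leaves the factor [5/6], enough because
     [5/6 * 25/24 * 107/100 < 1]. *)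
  have muH : mu * INR H = lam * (5 / 6) by rewrite /mu /lam; field; lra.
  have -> r : mu * (r * (1 + lam) ^ 3 * INR H) = lam * (5 / 6 * (r * (1 + lam) ^ 3)).
    by rewrite -[RHS]Rmult_assoc -muH; ring.
  rewrite -[X in _ <= X]Rmult_1_r; apply: Rmult_le_compat_l; first lra.
  have : ((1 + lam) ^ 2) ^ h.-1 * (1 + lam) ^ 3 <= 25 / 24 * (107 / 100).
    by apply: Rmult_le_compat => //; [apply/pow_le/pow2_ge_0 | apply: pow_le; lra].
  lra.
move=> hist size_h vh dev.
rewrite /f; case: Rle_dec => [?|[]] /=; first lra.
have K0 : (0 < size hist)%N by rewrite size_h.
have count_le j x a : (j <= size hist)%N -> (N2 (flatten (take j hist)) x a <= K * H)%N.
  move=> jK; apply: leq_trans (N2_le_size _ _ _) _.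
  rewrite -size_h -(valid_run_size_flatten vh) -[in X in (_ <= X)%N](cat_take_drop j hist).
  by rewrite flatten_cat size_cat leq_addr.
have vconc j : (j <= size hist)%N ->
    value_concentration a0 P rew H L (flatten (take j hist)).
  move=> jK; apply: (value_weight_concentration HP_nonneg HP_sum Hrew HH (T := (K * H)%N)) => //; first lra.
    by move=> x a; apply: count_le.
  move=> n m s x a /andP[n0 nT] mH.
  (* Ordinals start at [0], so the tilt for count [n] is stored at index [n.-1]. *)
  have nT' : (n.-1 < K * H)%N by rewrite prednK.
  rewrite size_h in jK; have := dev (inl (inl (x, a, Ordinal mH, Ordinal nT', s))) j jK.
  by rewrite /z /= prednK // run_weight_const LE.
have cconc j : (j <= size hist)%N -> count_concentration P lam l2 (flatten (take j hist)).
  move=> jK; apply: count_weight_concentration => // x a y.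
  rewrite size_h in jK; have := dev (inl (inr (x, a, y))) j jK.
  by rewrite /z run_weight_const.
have gapK : run_weight (fun pre => gap_weight a0 P rew H b lam pre (agent pre)) hist
    <= 60 * INR H ^ 2 * l3.
  have := dev (inr tt) K (leqnn K); rewrite take_oversize ?size_h //.
  rewrite [run_weight _ _](_ : _ = mu * run_weight (fun pre =>
    gap_weight a0 P rew H b lam pre (agent pre)) hist); last first.
    by rewrite /run_weight big_distrr; apply: eq_bigr => k _; apply: ep_weight_scale.
  (* Dividing by [mu] turns the deviation [l3] into [60 H^2 l3], independent of [K] apart from
     logarithms. *)
  move=> le; apply: (Rmult_le_reg_l mu) => //.
  by rewrite [X in _ <= X](_ : _ = l3) //; rewrite /mu; field; lra.
pose beta := 7 * INR H * L' + 2 * INR H * sqrt L.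
have beta0 : 0 <= beta.
  by have := sqrt_pos L; rewrite /beta => ?; apply: Rplus_le_le_0_compat; nra.
have b_opt n : (0 < n)%N -> 2 * INR H * sqrt (L / INR n) <= b n.
  by move=> n0; apply: bonus_le; [lra | exact: L'1 | split; [lra | exact: LL'] | exact: INR_ge1].
have b_beta n : (0 < n)%N -> b n + 2 * INR H * sqrt (L / INR n) <= beta / sqrt (INR n).
  move=> n0; have n1 := INR_ge1 n0; right.
  have sn : sqrt (INR n) <> 0 by apply/Rgt_not_eq/sqrt_lt_R0; lra.
  rewrite /b /bonus_CH -/L' sqrt_div ?sqrt_1; [|lra|lra].
  by rewrite sqrt_div; [rewrite /beta; field | lra | lra].
have rho h : (h <= H)%N -> ((1 + lam) ^ 2) ^ h.-1 <= 25 / 24 := @compound_growth H h HH.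
have l20 : 0 <= l2 by case: l2b.
have := regret_le HP_nonneg HP_sum Hrew HH lam0 l20 beta0 b_opt b_beta rho
  (fun hist h x a => @Htb hist h x a) vh K0 vconc cconc gapK.
rewrite size_h => /Rle_trans; apply.
have := @final_bound (INR H) (INR #|X|) (INR #|Ac|) (INR K) L L' l2 l3
  (ln (INR (K * H)) + 1) h1 S1 A1 k1 (conj L'1 L'L) l2b.
rewrite -TE; apply; last exact: l3L.
split=> //; rewrite -ln_1; have : ln 1 <= ln (INR (K * H)) by apply: ln_mono; lra.
by rewrite ln_1; lra.
Qed.
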